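(* Let $d\ge 3$ be an integer and $k=2$. For a finite field $\mathbb F_q$ let $$\mathcal H_2=\{x\in\mathbb F_q^d:\ x_1^{j+1}+x_2^{j+1}-x_{2+j}^{j+1}=0\ \text{ for all } j=1,\dots,d-2\},$$ with normalized surface measure $d\sigma_2$. Then, assuming the characteristic of $\mathbb F_q$ is sufficiently large (in terms of $d$), for $1\le p,r\le\infty$ the property $\mathfrak P(p,r)$ holds for $\mathcal H_2$ if and only if $(1/p,1/r)$ lies in the closed convex hull of the four points $(0,0),\ (0,1),\ (1,1),\ \left(\frac{d}{2d-2},\frac{d-2}{2d-2}\right)$ in $\mathbb R^2$.
   Context: $\mathbb F_q$ is a finite field with $q$ elements. $\mathbb F_q^d$ carries the normalized counting measure $dx$, so $\|f\|_{L^p(\mathbb F_q^d,dx)}=\big(q^{-d}\sum_{x\in\mathbb F_q^d}|f(x)|^p\big)^{1/p}$ for $1\le p<\infty$ and $\|f\|_{L^\infty}=\max_x|f(x)|$. For a nonempty set $V\subseteq\mathbb F_q^d$, the normalized surface measure $d\sigma$ on $V$ is given by $\int f\,d\sigma=\frac1{|V|}\sum_{x\in V}f(x)$, and $f*d\sigma(y)=\frac1{|V|}\sum_{x\in V}f(y-x)$. For a family of such sets $V$ (one for each admissible $q$), $\mathfrak P(p,r)$ means: there is a constant $C>0$ independent of $q$ and of $f$ such that $\|f*d\sigma\|_{L^r(\mathbb F_q^d,dx)}\le C\|f\|_{L^p(\mathbb F_q^d,dx)}$ for all $f:\mathbb F_q^d\to\mathbb C$ and all admissible $q$ (here: all $q$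 whose characteristic exceeds a sufficiently large bound depending on $d$). *)

(* Defs.v *)
From Stdlib Require Import Reals.
From HB Require Import structures.
From mathcomp Require Import all_boot all_order all_algebra all_field.

Set Implicit Arguments.
Unset Strict Implicit.
Unset Printing Implicit Defensive.

Section Variety.
Local Open Scope ring_scope.

(* k-th coordinate (0-based) of x in F^d; 0 if k >= d (never used out of range). *)
Definition coord (F : finFieldType) (d : nat) (x : 'rV[F]_d) (k : nat) : F :=
  match @insub nat (fun k : nat => (k < d)%N) 'I_d k with
  | Some i => x ord0 i
  | None => 0
  end.

(* x_1^{j+1} + x_2^{j+1} - x_{2+j}^{j+1} = 0 for all j = 1..d-2
   (1-based x_m is coord x (m-1)). *)
Definition H2b (F : finFieldType) (d : nat) (x : 'rV[F]_d) : bool :=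
  [forall j : 'I_d, ((1 <= j) && (j <= d - 2))%N ==>
     (coord x 0 ^+ j.+1 + coord x 1 ^+ j.+1 - coord x j.+1 ^+ j.+1 == 0)].

Definition H2set (F : finFieldType) (d : nat) : {set 'rV[F]_d} :=
  [set x | H2b x].

Definition vsub (F : finFieldType) (d : nat) (y x : 'rV[F]_d) : 'rV[F]_d := y - x.
End Variety.

Local Open Scope R_scope.

Definition Cx := (R * R)%type.
Definition cmod (z : Cx) : R := sqrt (fst z * fst z + snd z * snd z).

(* x^y for x >= 0, y > 0, with 0^y = 0 *)
Definition rpow (x y : R) : R := if Req_EM_T x 0 then 0 else Rpower x y.

Definition sumR (T : finType) (g : T -> R) : R := \big[Rplus/0]_(x : T) g x.
Definition sumIn (T : finType) (A : {set T}) (g : T -> R) : R :=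
  \big[Rplus/0]_(x in A) g x.
Definition maxR (T : finType) (g : T -> R) : R := \big[Rmax/0]_(x : T) g x.

(* L^p norm w.r.t. normalized counting measure on F^d, parametrized by
   s = 1/p in [0,1]; s = 0 means p = infinity. *)
Definition Lnorm (F : finFieldType) (d : nat) (s : R) (f : 'rV[F]_d -> Cx) : R :=
  if Req_EM_T s 0 then maxR (fun x => cmod (f x))
  else rpow (sumR (fun x => rpow (cmod (f x)) (/ s)) / INR (#|F| ^ d)%N) s.

Definition conv (F : finFieldType) (d : nat) (V : {set 'rV[F]_d})
  (f : 'rV[F]_d -> Cx) (y : 'rV[F]_d) : Cx :=
  (sumIn V (fun x => fst (f (vsub y x))) / INR #|V|,
   sumIn V (fun x => snd (f (vsub y x))) / INR #|V|).

(* Property P(p,r) for H_2, s = 1/p, t = 1/r, admissible fields: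
   characteristic > K. *)
Definition PropP (d K : nat) (s t : R) : Prop :=
  exists Cst : R, 0 < Cst /\
    forall (F : finFieldType),
      (forall p : nat, p \in GRing.pchar F -> (K < p)%N) ->
      forall f : 'rV[F]_d -> Cx,
        Lnorm t (conv (H2set F d) f) <= Cst * Lnorm s f.

Definition in_hull4 (d : nat) (s t : R) : Prop :=
  let x4 := INR d / (2 * INR d - 2) in
  let y4 := (INR d - 2) / (2 * INR d - 2) in
  exists a b c e : R,
    0 <= a /\ 0 <= b /\ 0 <= c /\ 0 <= e /\ a + b + c + e = 1 /\
    s = a * 0 + b * 0 + c * 1 + e * x4 /\
    t = a * 0 + b * 1 + c * 1 + e * y4.

(* Main.v *)
(** H_2 is a cone, so the L^2 size of averaging over H_2 at a frequency xi is
    governed by #{x in H_2 : x.xi = 0} alone, that is, by the number of points of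
    the curve y_m^m = 1 + t^m (2 <= m < d) on a hyperplane. This number is bounded
    in terms of d because, in large characteristic, the algebraic functions
    (1 + t^m)^(a/m) satisfy no linear relation with polynomial coefficients of low
    degree: their logarithmic derivatives have residues a/m at primitive 2m-th
    roots of unity. The same independence shows that a Stepanov auxiliary
    polynomial is nonzero, whence |H_2| >= c q^2. Off its mean, the averaging
    operator thus has norm O(1/q) on L^2, and its kernel is O(q^(d-2)). A dyadic
    decomposition balances the two bounds and yields, without loss, the estimate
    at the vertex (d/(2d-2), (d-2)/(2d-2)). As the operator is positive, weighted
    AM-GM with the trivial estimates at the other vertices gives the whole hull.
    Conversely, the point mass at 0 and the indicator function of -H_2, over F_p
    with p tending to infinity, force the two oblique sides of the hull. *)
Require Import Defs.
From Stdlib Require Import Reals.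
From HB Require Import structures.
From mathcomp Require Import all_boot all_order all_algebra all_solvable all_field.
From mathcomp Require Import ring lra zify Rstruct.
Set Implicit Arguments.
Unset Strict Implicit.
Unset Printing Implicit Defensive.
Import Order.TTheory GRing.Theory Num.Theory.
Local Open Scope ring_scope.
Arguments rpow (x y)%_ring_scope.
Arguments Lnorm F d s%_ring_scope f.

(** * Linear independence of products of powers of the 1 + X^m *)

Section Independence.
Variable L : fieldType.

(** The roots (1 + X^m)^(1/m), m >= 2, never appear as algebraic functions. They are replaced by
    polynomials (1 + X^m)^kappa, where n * kappa is 1 or -1 in F and n is m or gcd(m, q - 1). Such a
    polynomial is an m-th root of 1 + X^m modulo X^q in the hyperplane count, and a test for m-th
    powers on F in the Stepanov count. Both times kappa is 1/n or -1/n in F, so one independence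
    theorem serves both. Identities of functions become divisibility by X^T for T above a bound in d
    alone, so a lower bound on the characteristic in terms of d is all that is needed. The analytic
    side stays over an ordered field: hyperplane sums replace characters. A cone has equally many
    points on all levels x.xi = b with b nonzero, so the multiplier at xi is the integer N_0 - N_1,
    the difference of the counts on levels 0 and 1. The kernel being positive, interpolation reduces
    to a pointwise inequality and needs no complex method. *)

Lemma dvdXn_deriv (n : nat) (p : {poly L}) : 'X^(n.+1) %| p -> 'X^n %| p^`().
Proof.
case/dvdpP=> s ->; rewrite derivM derivXn /= dvdp_add //.
  by rewrite dvdp_mull // exprS dvdp_mull.
by rewrite mulrnAr -mulr_natl !dvdp_mull.
Qed.

Lemma size_deriv_leq (p : {poly L}) : (size p^`() <= (size p).-1)%N.
Proof.
apply/leq_sizeP=> i le_i; rewrite coef_deriv nth_default ?mul0rn //.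
by move: le_i; case: (size p).
Qed.

Lemma size_mul_bound (m n : nat) (p q : {poly L}) :
  (size p <= m)%N -> (size q <= n)%N -> (size (p * q)%R <= (m + n).-1)%N.
Proof.
move=> pm qn; apply: leq_trans (size_polyMleq p q) _.
by rewrite -!subn1 leq_sub2r // leq_add.
Qed.

(* Eliminating one term of a relation with the derivation P d/dX doubles the
   degrees and costs one order of vanishing at 0: hence 2 ^ n * (D + b) + n. *)
Lemma Wronskian_independence (I : finType) (P : {poly L}) (W l : I -> {poly L})
    (b n D T : nat) (A : {set I}) (r : I -> {poly L}) :
    (forall i, P * (W i)^`() = l i * W i) ->
    (forall i, (W i).[0] != 0) ->
    (size P <= b.+1)%N -> (forall i, size (l i) <= b)%N ->
    #|A| = n ->
    (forall i j, i \in A -> j \in A -> i != j -> forall s t : {poly L},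
      s != 0 -> t != 0 ->
      (size s <= 2 ^ n * (D + b))%N -> (size t <= 2 ^ n * (D + b))%N ->
      P * (s^`() * t - s * t^`()) != (l j - l i) * s * t) ->
    (2 ^ n * (D + b) + n <= T)%N ->
    (forall i, i \in A -> size (r i) <= D)%N ->
    'X^T %| \sum_(i in A) r i * W i ->
  forall i, i \in A -> r i = 0.
Proof.
move=> PW W0 sP sl; elim: n => [|n IHn] in D T A r *.
  by move/eqP; rewrite cards_eq0 => /eqP -> _ _ _ _ i; rewrite inE.
move=> cA sep leT sr dvdT.
have [i0 /andP[Ai0 r0]|r0] := pickP [pred i in A | r i != 0]; last first.
  by move=> i Ai; apply/eqP; have := r0 i; rewrite /= Ai /= => /negbFE.
have le2 : (D <= 2 ^ n.+1 * (D + b))%N.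
  by rewrite (leq_trans (leq_addr b D)) // leq_pmull // expn_gt0.
(* [s i * W i] is [P] times the derivative of [r i * W i]: the relation can be differentiated
   without leaving the span of the [W i]. *)
pose s i : {poly L} := P * (r i)^`() + l i * r i.
have ss i : i \in A -> (size (s i) <= D + b)%N.
  move=> Ai; apply: leq_trans (size_polyD _ _) _.
  rewrite geq_max; apply/andP; split.
    rewrite addnC; apply: size_mul_bound sP _.
    by rewrite (leq_trans (size_deriv_leq _)) // (leq_trans (leq_pred _)) // sr.
  by rewrite addnC (leq_trans (size_mul_bound (sl i) (sr i Ai))) ?leq_pred.
(* The combination of the relation and its derivative in which [W i0] cancels. *)
pose r' i : {poly L} := r i0 * s i - s i0 * r i.
have r'i0 : r' i0 = 0 by rewrite /r' mulrC subrr.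
have r'0 i : i \in A :\ i0 -> r' i = 0.
  apply: (IHn (D + D + b)%N T.-1 (A :\ i0) r').
  - by have := cardsD1 i0 A; rewrite Ai0 cA => -[].
  (* The new size bound 2D + b doubles D + b, so the bound in [sep] keeps its value along the
     induction and the hypothesis is reused unchanged. *)
  - have e2 : (2 ^ n * (D + D + b + b) = 2 ^ n.+1 * (D + b))%N.
      by rewrite expnS; lia.
    rewrite e2 => i1 j1; rewrite !inE => /andP[_ Ai] /andP[_ Aj].
    exact: sep.
  - by move: leT; rewrite expnS; lia.
  - move=> j; rewrite !inE => /andP[_ Aj].
    apply: leq_trans (size_polyD _ _) _; rewrite geq_max size_polyN.
    rewrite -addnA (leq_trans (size_mul_bound (sr _ Ai0) (ss _ Aj))) ?leq_pred //.
    by rewrite addnC (leq_trans (size_mul_bound (ss _ Ai0) (sr _ Aj))) ?leq_pred.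
  have -> : \sum_(i in A :\ i0) r' i * W i =
      r i0 * (P * (\sum_(i in A) r i * W i)^`()) - s i0 * (\sum_(i in A) r i * W i).
    transitivity (\sum_(i in A) r' i * W i).
      rewrite [RHS](bigD1 i0) //= r'i0 mul0r add0r.
      by apply: eq_bigl => j; rewrite !inE andbC.
    rewrite raddf_sum !mulr_sumr -sumrB; apply: eq_bigr => j _.
    rewrite /= derivM /r' /s.
    have -> : P * ((r j)^`() * W j + r j * (W j)^`()) =
      P * (r j)^`() * W j + r j * (P * (W j)^`()) by ring.
    by rewrite PW; ring.
  have T1 : T = T.-1.+1 by move: leT; rewrite expnS; lia.
  rewrite dvdp_sub //; last first.
    by rewrite dvdp_mull // (dvdp_trans _ dvdT) // dvdp_exp2l // leq_pred.
  by rewrite !dvdp_mull // dvdXn_deriv // -T1.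
(* [r' i = 0] says that [r i * W i] and [r i0 * W i0] have equal logarithmic derivatives, which
   [sep] excludes unless [r i = 0]. *)
have ri0 i : i \in A -> i != i0 -> r i = 0.
  move=> Ai nei; apply/eqP/negP=> /negP rn0.
  have ls : (size (r i) <= 2 ^ n.+1 * (D + b))%N by apply: leq_trans (sr _ Ai) le2.
  have lt : (size (r i0) <= 2 ^ n.+1 * (D + b))%N by apply: leq_trans (sr _ Ai0) le2.
  have /negP[] := sep i i0 Ai Ai0 nei _ _ rn0 r0 ls lt.
  have := r'0 i; rewrite !inE nei Ai => /(_ isT)/eqP; rewrite subr_eq0 /s => /eqP E.
  apply/eqP; rewrite mulrBr mulrBl.
  have -> : P * ((r i)^`() * r i0) = r i0 * (P * (r i)^`() + l i * r i) - l i * r i * r i0.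
    by ring.
  by rewrite E; ring.
(* One term is left, and [W i0] is prime to X: X^T would divide [r i0], whose size is at most D. *)
exfalso; move: dvdT; rewrite (bigD1 i0) //= big1 ?addr0; last first.
  by move=> i /andP[Ai nei]; rewrite ri0 ?mul0r.
rewrite Gauss_dvdpl; last first.
  by rewrite coprimep_expl // coprimep_sym coprimepX rootE W0.
move/(dvdp_leq r0); rewrite size_polyXn.
move=> /leq_trans/(_ (sr _ Ai0))/leq_trans/(_ le2) ltT.
have := leq_trans ltT (leq_addr n.+1 _).
by move/leq_trans/(_ leT); rewrite ltnn.
Qed.

End Independence.

(** * Multiplicities and logarithmic derivatives of products of binomials *)

Section BinomialPowers.
Variable L : fieldType.

(** The logarithmic derivatives agree, and the residue of f'/f at x is the multiplicity of x, read
    in L. In characteristic p only its class mod p is determined. *)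
Lemma mup_Wronskian0 (x : L) (f g : {poly L}) : f != 0 -> g != 0 ->
  f^`() * g = f * g^`() -> (mup x f)%:R = (mup x g)%:R :> L.
Proof.
move=> f0 g0 E.
have decomp (h : {poly L}) : h != 0 -> exists2 h1 : {poly L}, h1.[x] != 0 &
    h = h1 * ('X - x%:P) ^+ (mup x h).
  move=> h0; have [n [q]] := multiplicity_XsubC h x; rewrite h0 /= => qx ->.
  exists q; first exact: qx.
  rewrite mupMr // mup_XsubCX eqxx //.
have [f1 f1x fE] := decomp _ f0; have [g1 g1x gE] := decomp _ g0.
move: (mup x f) (mup x g) fE gE => a b fE gE.
have dX (n : nat) : ('X - x%:P) * (('X - x%:P) ^+ n)^`() = n%:R * ('X - x%:P) ^+ n :> {poly L}.
  case: n => [|n]; first by rewrite expr0 derivC mulr0 mul0r.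
  by rewrite deriv_exp derivXsubC mul1r -mulr_natl exprS mulrCA.
have : ('X - x%:P) ^+ (a + b) * ((a%:R - b%:R) * f1 * g1 + ('X - x%:P) * (f1^`() * g1 - f1 * g1^`())) = 0.
  have : ('X - x%:P) * (f^`() * g) - ('X - x%:P) * (f * g^`()) = 0 by rewrite E subrr.
  rewrite fE gE !derivM => <-.
  transitivity (('X - x%:P) * (f1^`() * ('X - x%:P) ^+ a * (g1 * ('X - x%:P) ^+ b))
    + f1 * (('X - x%:P) * (('X - x%:P) ^+ a)^`()) * (g1 * ('X - x%:P) ^+ b)
    - ('X - x%:P) * (f1 * ('X - x%:P) ^+ a * (g1^`() * ('X - x%:P) ^+ b))
    - f1 * ('X - x%:P) ^+ a * g1 * (('X - x%:P) * (('X - x%:P) ^+ b)^`())); last by ring.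
  by rewrite !dX exprD; ring.
move/eqP; rewrite mulf_eq0 expf_eq0 polyXsubC_eq0 andbF /= => /eqP/(congr1 (horner^~ x)).
rewrite !hornerE subrr mul0r addr0 => /eqP; rewrite !mulf_eq0 (negbTE f1x) (negbTE g1x) !orbF.
by rewrite -!polyC_natr !hornerC subr_eq0 => /eqP.
Qed.

(** The product of the [f i] clears the denominators of the logarithmic derivative whatever the
    exponents [e]. A common multiplier for all exponent vectors is what [Wronskian_independence]
    requires of [P]. *)
Lemma deriv_prod_powers (I : Type) (s : seq I) (e : I -> nat) (f : I -> {poly L})
    (b : I -> nat) :
    (forall i, size (f i) <= (b i).+1)%N ->
  exists2 l : {poly L}, (size l <= \sum_(i <- s) b i)%N &
    (\prod_(i <- s) f i) * (\prod_(i <- s) f i ^+ e i)^`() =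
    l * \prod_(i <- s) f i ^+ e i.
Proof.
move=> sf; elim: s => [|i s [l sl E]].
  by exists 0; rewrite !big_nil ?size_poly0 // derivC mulr0 mul0r.
pose l' : {poly L} := (e i)%:R * (f i)^`() * (\prod_(i <- s) f i) + f i * l.
exists l'.
  rewrite big_cons; apply: leq_trans (size_polyD _ _) _; rewrite geq_max; apply/andP; split.
    have sP : (size (\prod_(i <- s) f i)%R <= (\sum_(i <- s) b i).+1)%N.
      elim: (s) => [|j t IHt]; first by rewrite !big_nil size_poly1.
      by rewrite !big_cons; apply: leq_trans (size_mul_bound (sf j) IHt) _; lia.
    have sd : (size ((e i)%:R * (f i)^`() : {poly L})%R <= b i)%N.
      rewrite -polyC_natr mul_polyC; apply: leq_trans (size_scale_leq _ _) _.
      by apply: leq_trans (size_deriv_leq _) _; rewrite -ltnS; case: size (sf i).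
    by apply: leq_trans (size_mul_bound sd sP) _; lia.
  by apply: leq_trans (size_mul_bound (sf i) sl) _; lia.
rewrite !big_cons derivM /l' mulrDr mulrDl.
have -> : f i * (\prod_(j <- s) f j) * (f i ^+ e i * (\prod_(j <- s) f j ^+ e j)^`()) =
  f i * f i ^+ e i * ((\prod_(j <- s) f j) * (\prod_(j <- s) f j ^+ e j)^`()) by ring.
rewrite E deriv_exp -[_ *+ _]mulr_natl.
case: (e i) => [|n]; first by rewrite !mul0r /=; ring.
by rewrite /= !exprS; ring.
Qed.

Lemma mup_prod_powers (I : Type) (s : seq I) (e : I -> nat) (f : I -> {poly L}) (x : L) :
    (forall i, f i != 0) ->
  mup x (\prod_(i <- s) f i ^+ e i) = (\sum_(i <- s) e i * mup x (f i))%N.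
Proof.
move=> f0; elim: s => [|i s IHs].
  by rewrite !big_nil mupNroot // rootE hornerC oner_neq0.
rewrite !big_cons mupM ?expf_neq0 //; last first.
  by elim/big_ind: _ => [|p q p0 q0|j _]; rewrite ?oner_neq0 ?mulf_neq0 ?expf_neq0.
rewrite IHs; congr (_ + _)%N; elim: (e i) => [|n IHn].
  by rewrite mul0n expr0 mupNroot // rootE hornerC oner_neq0.
by rewrite exprS mupM ?expf_neq0 // IHn mulSn.
Qed.

Lemma mup_oneD_Xn (n : nat) (z : L) : (0 < n)%N -> (2 * n).-primitive_root z ->
  mup z (1 + 'X^n) = 1%N.
Proof.
move=> n0 pz.
have n2 : (2 * n)%:R != 0 :> L by apply: prim_root_natf_neq0 pz.
have f0 : 1 + 'X^n != 0 :> {poly L}.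
  by rewrite addrC -size_poly_eq0 (size_XnaddC (1 : L)).
have zn : z ^+ n = -1.
  have : (z ^+ n) ^+ 2 = 1 by rewrite -exprM mulnC (prim_expr_order pz).
  move/eqP; rewrite sqrf_eq1 => /orP[|/eqP //].
  rewrite -(prim_order_dvd pz) => /dvdn_leq -/(_ n0); lia.
have z0 : z != 0.
  apply: contra_eq_neq zn => ->; rewrite expr0n; case: (n) n0 => //= _ _.
  by rewrite eq_sym oppr_eq0 oner_neq0.
apply/eqP; rewrite eqn_leq mup_leq // mup_geq // expr1 dvdp_XsubCl rootE !hornerE zn.
rewrite subrr eqxx andbT; apply/negP => /dvdpP[s E].
have /(congr1 (fun p => p.[z])) : (1 + 'X^n)^`() = (s * ('X - z%:P) ^+ 2)^`() by rewrite E.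
rewrite derivD derivC add0r derivXn derivM deriv_exp derivXsubC /=.
rewrite !(hornerE, hornerXn, hornerMn) subrr /= !(mulr0, mul0r, mul0rn, add0r, addr0) => /eqP.
rewrite subrr mulr0 -mulr_natl mulf_eq0 expf_eq0 (negbTE z0) andbF orbF.
by move: n2; rewrite natrM mulf_eq0 negb_or => /andP[_ /negbTE->].
Qed.

Lemma mup_oneD_Xn0 (n m : nat) (z : L) : (2 * n).-primitive_root z -> (m < n)%N ->
  mup z (1 + 'X^m) = 0%N.
Proof.
move=> pz lt_mn; apply: mupNroot; rewrite rootE !hornerE.
have n2 : (2 * n)%:R != 0 :> L by apply: prim_root_natf_neq0 pz.
case: m lt_mn => [|m] lt_mn.
  by rewrite ?expr0; move: n2; rewrite natrM mulf_eq0 negb_or => /andP[].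
apply/negP; rewrite addrC addr_eq0 => /eqP zm.
have : z ^+ (m.+1 * 2) == 1 by rewrite exprM zm sqrrN expr1n.
by rewrite -(prim_order_dvd pz) => /dvdn_leq; lia.
Qed.
End BinomialPowers.

Lemma primitive_root_exists (L : closedFieldType) (n : nat) :
  n%:R != 0 :> L -> exists z : L, n.-primitive_root z.
Proof.
move=> n0; have n_gt0 : (0 < n)%N by case: n n0 => //; rewrite eqxx.
pose p : {poly L} := 'X^n - 1; have [r Dp] := closed_field_poly_normal p.
rewrite (monicP _) ?monicXnsubC // scale1r in Dp.
have rn1 : all n.-unity_root r by apply/allP=> z; rewrite -root_prod_XsubC -Dp.
have sz_r : (n < (size r).+1)%N.
  by rewrite -(size_prod_XsubC r id) -Dp size_XnsubC.
have [|z] := hasP (has_prim_root n_gt0 rn1 _ sz_r); last by exists z.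
by rewrite -separable_prod_XsubC -Dp cyclotomic.separable_Xn_sub_1.
Qed.

Lemma mup_leq_size (L : fieldType) (z : L) (s : {poly L}) : s != 0 ->
  (mup z s <= size s)%N.
Proof.
move=> s0; have : ('X - z%:P) ^+ (mup z s) %| s by rewrite -mup_geq.
by move/(dvdp_leq s0); rewrite size_exp_XsubC => /ltnW.
Qed.

(* At a primitive 2 m0-th root of unity, 1 + X^m0 vanishes simply and no
   1 + X^m with m < m0 vanishes; the last clause keeps the multiplicities of
   s * prod (1 + X^m) ^ k m and t * prod (1 + X^m) ^ k' m there apart in F. *)
Definition distinguishable (F : nzRingType) (d E : nat) (k k' : 'I_d -> nat) :=
  exists m0 : 'I_d, [/\ (0 < m0)%N,
    (forall m : 'I_d, (m0 < m)%N -> (k m)%:R = (k' m)%:R :> F) &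
    (forall v w : nat, (v <= E)%N -> (w <= E)%N -> (v + k m0)%:R != (w + k' m0)%:R :> F)].

Section BinomialIndependence.
Variable d : nat.
Local Notation binomial_prod k := (\prod_(m < d) (1 + 'X^m) ^+ k m).
Local Notation b := (\sum_(m < d) m)%N.

(** A relation excluded by [sep] in [Wronskian_independence] would equate the multiplicities, in L,
    of s W_i and t W_j at a primitive 2 m0-th root of unity. There the factors with m < m0
    contribute nothing, those with m > m0 contribute equally, and the multiplicities of s and t are
    bounded by their sizes. *)
Lemma binomial_independence_closed (L : closedFieldType) (I : finType) (k : I -> 'I_d -> nat)
    (A : {set I}) (D T : nat) (r : I -> {poly L}) :
    (0 < d)%N -> (forall m, (0 < m <= 2 * d)%N -> m%:R != 0 :> L) ->
    (forall i j, i \in A -> j \in A -> i != j ->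
      distinguishable L (2 ^ #|A| * (D + b)) (k i) (k j)) ->
    (2 ^ #|A| * (D + b) + #|A| <= T)%N ->
    (forall i, i \in A -> size (r i) <= D)%N ->
    'X^T %| \sum_(i in A) r i * binomial_prod (k i) ->
  forall i, i \in A -> r i = 0.
Proof.
move=> d0 char0 sep leT sr dvdT i Ai.
have two : 2%:R != 0 :> L by apply: char0; lia.
have sf (m : 'I_d) : (size (1 + 'X^m : {poly L})%R <= m.+1)%N.
  by rewrite (leq_trans (size_polyD _ _)) // geq_max size_poly1 size_polyXn leqnn.
have f0 (m : 'I_d) : 1 + 'X^m != 0 :> {poly L}.
  apply/eqP => /(congr1 (horner^~ 0)); rewrite !hornerE expr0n /=.
  by case: (nat_of_ord m == 0%N) => /eqP; rewrite ?addr0 ?oner_eq0 ?(negbTE two).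
have P0 : \prod_(m < d) (1 + 'X^m) != 0 :> {poly L}.
  by elim/big_ind: _ => [|p q ? ?|j _]; rewrite ?oner_neq0 ?mulf_neq0.
have W0 j : binomial_prod (k j) != 0 :> {poly L}.
  by elim/big_ind: _ => [|p q ? ?|m _]; rewrite ?oner_neq0 ?mulf_neq0 ?expf_neq0.
have [l sl PW] := fin_all_exists2 (fun j => deriv_prod_powers (index_enum 'I_d) (k j) sf).
have H := Wronskian_independence PW _ _ sl.
apply: (H #|A| D T A r _ _ (erefl _) _ leT sr dvdT i Ai).
- move=> j; rewrite horner_prod; elim/big_ind: _ => [|p q ? ?|m _]; rewrite ?oner_neq0 ?mulf_neq0 //.
  rewrite !hornerE expf_neq0 // expr0n.
  by case: (nat_of_ord m == 0%N); rewrite ?addr0 ?oner_neq0.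
- elim: (index_enum 'I_d) => [|j t IHt]; first by rewrite !big_nil size_poly1.
  by rewrite !big_cons; apply: leq_trans (size_mul_bound (sf j) IHt) _; lia.
move=> j1 j2 A1 A2 ne s t s0 t0 ss st; apply/eqP => E.
have [m0 [m0_gt0 kmax kne]] := sep _ _ A1 A2 ne.
have /primitive_root_exists[z pz] : (2 * m0)%:R != 0 :> L.
  by apply: char0; have := ltn_ord m0; lia.
have EW : (s * binomial_prod (k j1))^`() * (t * binomial_prod (k j2)) =
   (s * binomial_prod (k j1)) * (t * binomial_prod (k j2))^`().
  apply: (mulfI P0); rewrite !derivM.
  set P := \prod_(m < d) _ in PW E *; set W1 := binomial_prod (k j1); set W2 := binomial_prod (k j2).
  have E1 := PW j1; have E2 := PW j2; rewrite -/W1 in E1; rewrite -/W2 in E2.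
  transitivity (P * s^`() * t * W1 * W2 + s * t * W2 * (P * W1^`())); first by ring.
  rewrite E1.
  transitivity (P * s * t^`() * W1 * W2 + s * t * W1 * (P * W2^`())); last by ring.
  rewrite E2; apply/eqP; rewrite -subr_eq0; apply/eqP.
  transitivity ((P * (s^`() * t - s * t^`()) - (l j2 - l j1) * s * t) * W1 * W2); first by ring.
  by rewrite E subrr !mul0r.
have := mup_Wronskian0 z (mulf_neq0 s0 (W0 j1)) (mulf_neq0 t0 (W0 j2)) EW.
rewrite !mupM // !mup_prod_powers //.
have mupE j : (\sum_(m < d) k j m * mup z (1 + 'X^m))%:R =
   (k j m0)%:R + \sum_(m < d | (m0 < m)%N) (k j m)%:R * (mup z (1 + 'X^m))%:R :> L.
  rewrite natr_sum (bigD1 m0) //= mup_oneD_Xn // muln1; congr (_ + _).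
  rewrite (bigID (fun m : 'I_d => (m0 < m)%N)) /= [X in _ + X]big1 ?addr0; last first.
    move=> m /andP[nem]; rewrite -leqNgt => le_m.
    by rewrite (mup_oneD_Xn0 pz) ?muln0 // ltn_neqAle le_m andbT.
  apply: eq_big => m; last by rewrite natrM.
  by case: eqVneq => [->|]; rewrite ?ltnn.
rewrite !natrD !mupE; under eq_bigr => m lt_m do rewrite kmax //.
rewrite !addrA => /addIr; rewrite -!natrD; apply/eqP/kne.
  exact: leq_trans (mup_leq_size _ s0) ss.
exact: leq_trans (mup_leq_size _ t0) st.
Qed.

(** The roots of unity may lie outside F, hence the passage to an algebraic closure. Sizes,
    divisibility and images of integers are all preserved. *)
Lemma binomial_independence (F : finFieldType) (I : finType) (k : I -> 'I_d -> nat)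
    (A : {set I}) (D T : nat) (r : I -> {poly F}) :
    (0 < d)%N -> (forall m, (0 < m <= 2 * d)%N -> m%:R != 0 :> F) ->
    (forall i j, i \in A -> j \in A -> i != j ->
      distinguishable F (2 ^ #|A| * (D + b)) (k i) (k j)) ->
    (2 ^ #|A| * (D + b) + #|A| <= T)%N ->
    (forall i, i \in A -> size (r i) <= D)%N ->
    'X^T %| \sum_(i in A) r i * binomial_prod (k i) ->
  forall i, i \in A -> r i = 0.
Proof.
move=> d0 char0 sep leT sr dvdT i Ai.
have [K [toK _]] := countable_algebraic_closure F.
have rmap (m : nat) : toK m%:R = m%:R by rewrite rmorph_nat.
apply/eqP; rewrite -(map_poly_eq0 toK); apply/eqP.
apply: (@binomial_independence_closed K I k A D T (fun j => map_poly toK (r j))) => //.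
- by move=> m lem; rewrite -rmap fmorph_eq0 char0.
- move=> i1 j1 A1 A2 ne; have [m0 [m0_gt0 kmax kne]] := sep _ _ A1 A2 ne.
  exists m0; split=> // [m lt_m|v w lev lew]; first by rewrite -!rmap kmax.
  by rewrite -!rmap (inj_eq (fmorph_inj toK)) kne.
- by move=> j Aj; rewrite size_map_poly sr.
move: dvdT; rewrite -(dvdp_map toK) map_polyXn rmorph_sum /=.
congr (_ %| _); apply: eq_bigr => j _; rewrite rmorphM rmorph_prod /=.
congr (_ * _); apply: eq_bigr => m _.
by rewrite rmorphXn rmorphD rmorph1 /= map_polyXn.
Qed.
End BinomialIndependence.

(** * Hyperplane sections of the curve *)

Lemma pigeonhole (U V : finType) (phi : U -> V) : (#|V| < #|U|)%N ->
  exists u v, u != v /\ phi u = phi v.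
Proof.
move=> ltVU; have [/injectiveP inj|/injectivePn[u [v neq E]]] := boolP (injectiveb phi).
  by move: ltVU; rewrite ltnNge (leq_card _ inj).
by exists u, v.
Qed.

(** A dimension count done by counting: over a finite field the polynomials of bounded size form a
    finite set, so two inputs share an image, and their difference is a nonzero solution. *)
Lemma poly_system_solution (F : finFieldType) (I J : finType) (B B' : nat)
    (Phi : (I -> {poly F}) -> J -> {poly F}) :
    (forall r s j, Phi (fun i => r i - s i) j = Phi r j - Phi s j) ->
    (forall r s, r =1 s -> Phi r =1 Phi s) ->
    (forall r : I -> {poly F}, (forall i, size (r i) <= B)%N -> forall j, size (Phi r j) <= B')%N ->
    (#|J| * B' < #|I| * B)%N ->
  exists r : I -> {poly F}, [/\ forall i, (size (r i) <= B)%N, exists i, r i != 0 & forall j, Phi r j = 0].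
Proof.
move=> PhiB Phiext Phisize lt.
pose phi (u : {ffun I -> 'rV[F]_B}) : {ffun J -> 'rV[F]_B'} :=
  [ffun j => poly_rV (Phi (fun i => rVpoly (u i)) j)].
have [|u [v [neuv E]]] := pigeonhole phi.
  rewrite !card_ffun !card_mx !mul1n -!expnM ltn_exp2l ?card_finNzRing_gt1 //.
  by rewrite mulnC [(B * _)%N]mulnC.
exists (fun i => rVpoly (u i) - rVpoly (v i)); split => [i||j].
- by rewrite -raddfB size_poly.
- have [i ui] : exists i, u i != v i.
    apply/existsP; apply: contraNT neuv; rewrite negb_exists => /forallP u0.
    by apply/eqP/ffunP => i; apply/eqP; have := u0 i; rewrite negbK.
  exists i; rewrite subr_eq0; apply: contra ui => /eqP ui.
  by rewrite -[u i]rVpolyK ui rVpolyK.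
rewrite PhiB.
have := congr1 (fun f : {ffun J -> 'rV[F]_B'} => rVpoly (f j)) E; rewrite !ffunE.
rewrite !poly_rV_K; try by apply: Phisize => i; exact: size_poly.
by move->; rewrite subrr.
Qed.

Definition large_char (F : nzRingType) (K : nat) :=
  forall m, (0 < m <= K)%N -> m%:R != 0 :> F.

Lemma large_char_inj (F : nzRingType) (K a b : nat) : large_char F K ->
  (a <= K)%N -> (b <= K)%N -> a%:R = b%:R :> F -> a = b.
Proof.
move=> char0; wlog le_ab : a b / (a <= b)%N => [hw aK bK E|].
  by case/orP: (leq_total a b) => ?; [apply: hw|apply/esym/hw].
move=> aK bK E; apply/eqP; rewrite eqn_leq le_ab leqNgt; apply/negP => lt_ab.
have /negP[] : (b - a)%:R != 0 :> F by apply: char0; lia.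
by rewrite natrB // E subrr.
Qed.

Section Distinguishable.
Variables (F : nzRingType) (d : nat) (E : 'I_d -> nat) (kappa : 'I_d -> nat) (s : F).
Hypothesis E0 : forall m : 'I_d, m = 0%N :> nat -> E m = 0%N.
Hypothesis s_unit : s = 1 \/ s = -1.
Hypothesis kappaE : forall m, (E m).+1%:R * (kappa m)%:R = s.

(** Multiplying v + a kappa by E + 1 turns it, in F, into (E + 1) v + a or (E + 1) v - a. These
    integers are too small to coincide mod p by accident, and their residue mod E + 1 recovers a, as
    a <= E. The index [m0] is the largest one where the two vectors differ. *)
Lemma distinguishable_exponents (N K : nat) (a b : 'I_d -> nat) :
    large_char F K -> (forall m, (E m).+1 * N.+1 <= K)%N ->
    (forall m, a m <= E m)%N -> (forall m, b m <= E m)%N ->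
    ~~ [forall m, a m == b m] ->
  distinguishable F N (fun m => a m * kappa m)%N (fun m => b m * kappa m)%N.
Proof.
move=> char0 leK aE bE; rewrite negb_forall => /existsP[m1 ne1].
have [m0 /= ne0 max0] := @arg_maxnP _ m1 (fun m => a m != b m) (fun m => nat_of_ord m) ne1.
exists m0; split.
- rewrite lt0n; apply: contra ne0 => /eqP m00.
  by have := aE m0; have := bE m0; rewrite (E0 m00) !leqn0 => /eqP-> /eqP->.
- move=> m lt_m; suff -> : a m = b m by [].
  by apply/eqP; apply: contraLR lt_m => ne; rewrite -leqNgt; exact: max0.
move=> v w lev lew; apply/negP => /eqP/(congr1 (fun x => (E m0).+1%:R * x)).
rewrite !natrD !natrM !mulrDr.
have swap (c : nat) : (E m0).+1%:R * (c%:R * (kappa m0)%:R) = c%:R * s.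
  by rewrite mulrA -natrM mulnC natrM -mulrA kappaE.
rewrite !swap -!natrM.
have bound (u c : nat) : (u <= N)%N -> (c <= E m0)%N -> ((E m0).+1 * u + c <= K)%N.
  by move=> leu lec; apply: leq_trans (leK m0); rewrite mulnS addnC leq_add ?leq_mul // ltnW.
have nat_ne (u w' x y : nat) : (u <= N)%N -> (w' <= N)%N -> (x <= E m0)%N -> (y <= E m0)%N ->
    ((E m0).+1 * u + x)%:R = ((E m0).+1 * w' + y)%:R :> F -> x = y.
  move=> leu lew' lex ley /(large_char_inj char0 (bound _ _ leu lex) (bound _ _ lew' ley)).
  move/(congr1 (modn^~ (E m0).+1)); rewrite ![((E m0).+1 * _)%N]mulnC.
  by rewrite !modnMDl !modn_small.
case: s_unit => ->.
  rewrite !mulr1 -!natrD => /(nat_ne _ _ _ _ lev lew (aE _) (bE _)) ab.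
  by rewrite ab eqxx in ne0.
(* For s = -1 the subtracted terms change sides, which exchanges v and w. *)
rewrite !mulrN !mulr1 => /eqP; rewrite subr_eq addrAC eq_sym subr_eq -!natrD => /eqP.
move/(nat_ne _ _ _ _ lew lev (aE _) (bE _)) => ab.
by rewrite ab eqxx in ne0.
Qed.
End Distinguishable.

(** * Arithmetic in the monomial basis *)

Section Monomials.
Variables (d : nat) (E : 'I_d -> nat).

(* Exponents of the basis monomials of F[X][Y] / (Y_m ^ (E m + 1) - g m). *)
Definition exponents := {dffun forall m : 'I_d, 'I_(E m).+1}.

Definition exponents0 : exponents := [ffun m => ord0].

Definition exponents_succ (m : 'I_d) (a : exponents) : exponents :=
  [ffun m' => if m' == m then ordS (a m') else a m'].

Variable R : comNzRingType.

Definition monomial (Y : 'I_d -> R) (a : exponents) : R := \prod_m Y m ^+ a m.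

(* The factor produced when multiplying by Y m wraps the exponent of Y m to 0. *)
Definition carry (g : 'I_d -> R) (m : 'I_d) (a : exponents) : R :=
  if a m == E m :> nat then g m else 1.

Lemma monomial0 Y : monomial Y exponents0 = 1.
Proof. by rewrite /monomial big1 // => m _; rewrite ffunE expr0. Qed.
End Monomials.

Lemma card_exponents (d : nat) (E : 'I_d -> nat) :
  #|exponents E| = (\prod_(m < d) (E m).+1)%N.
Proof.
rewrite /exponents card_dep_ffun foldrE big_map enumT; apply: eq_bigr => m _.
by rewrite card_ord.
Qed.

Section Reduction.
Variables (F : fieldType) (d : nat) (E : 'I_d -> nat) (p : {poly F}).
Variables (Y g : 'I_d -> {poly F}).
Hypothesis Yg : forall m, p %| Y m ^+ (E m).+1 - g m.

Lemma monomial_succ (m : 'I_d) (a : exponents E) :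
  p %| Y m * monomial Y a - carry g m a * monomial Y (exponents_succ m a).
Proof.
rewrite /monomial (bigD1 m) //= [in X in _ - X](bigD1 m) //=.
set rest := \prod_(i | i != m) _.
have -> : \prod_(i | i != m) Y i ^+ exponents_succ m a i = rest.
  by apply: eq_bigr => i /negbTE nei; rewrite ffunE nei.
rewrite ffunE eqxx /= /carry.
have := ltn_ord (a m); rewrite ltnS leq_eqVlt; case: eqVneq => /= [->|_] lt_a.
  rewrite modnn expr0 mul1r mulrA -exprS -mulrBl dvdp_mulr //.
by rewrite modn_small // exprS mul1r mulrA subrr dvdp0.
Qed.

Variable xi : 'I_d -> F.
(* Coordinates of (sum_m xi m * Y m) * h - c in the monomial basis. *)
Definition multiplication_defect (h : exponents E -> {poly F}) (c : {poly F}) (b : exponents E) :=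
  \sum_a \sum_m ((xi m)%:P * carry g m a * h a) *+ (exponents_succ m a == b)
  - c *+ (b == exponents0 E).

(** The defect involves [h], [c], [g] and [xi] but neither [Y] nor [p]. Once it vanishes, one
    congruence holds both for p = X^q, with truncated roots, and for p = X - t, with the coordinates
    of an actual point. *)
Lemma multiplication_defectP (h : exponents E -> {poly F}) (c : {poly F}) :
  p %| (\sum_m (xi m)%:P * Y m) * (\sum_a h a * monomial Y a) - c -
       \sum_b multiplication_defect h c b * monomial Y b.
Proof.
have -> : \sum_b multiplication_defect h c b * monomial Y b =
   \sum_a \sum_m (xi m)%:P * carry g m a * h a * monomial Y (exponents_succ m a) - c.
  rewrite /multiplication_defect; under eq_bigr do rewrite mulrBl.
  rewrite sumrB; congr (_ - _); last first.
    rewrite (bigD1 (exponents0 E)) //= eqxx monomial0 mulr1 big1 ?addr0 // => b /negbTE->.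
    by rewrite mul0r.
  under eq_bigr do rewrite mulr_suml.
  rewrite exchange_big; apply: eq_bigr => a _.
  under eq_bigr do rewrite mulr_suml.
  rewrite exchange_big; apply: eq_bigr => m _.
  rewrite (bigD1 (exponents_succ m a)) //= eqxx big1 ?addr0 // => b; rewrite eq_sym => /negbTE->.
  by rewrite mul0r.
have -> : (\sum_m (xi m)%:P * Y m) * (\sum_a h a * monomial Y a) - c -
    (\sum_a \sum_m (xi m)%:P * carry g m a * h a * monomial Y (exponents_succ m a) - c) =
  \sum_a \sum_m (xi m)%:P * h a * (Y m * monomial Y a - carry g m a * monomial Y (exponents_succ m a)).
  rewrite opprB addrA subrK mulr_sumr -sumrB; apply: eq_bigr => a _.
  rewrite mulr_suml -sumrB; apply: eq_bigr => m _; ring.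
by elim/big_ind: _ => [|x y|a _]; rewrite ?dvdp0 //; [exact: dvdp_add|];
   elim/big_ind: _ => [|x y|m _]; rewrite ?dvdp0 //; [exact: dvdp_add|];
   rewrite dvdp_mull // monomial_succ.
Qed.
End Reduction.

Lemma large_char_card (F : finFieldType) (K : nat) : large_char F K -> (K < #|F|)%N.
Proof.
move=> char0; have inj : injective (fun i : 'I_K.+1 => (i%:R : F)).
  move=> i j E; apply: val_inj.
  exact: (large_char_inj char0 (leq_ord i) (leq_ord j) E).
by have := leq_card _ inj; rewrite card_ord.
Qed.

Lemma large_charW (F : nzRingType) (K K' : nat) : (K' <= K)%N -> large_char F K -> large_char F K'.
Proof. by move=> le char0 m /andP[m0 lem]; rewrite char0 // m0 (leq_trans lem). Qed.

Lemma oneD_Xn_exp_card (F : finFieldType) (m : nat) :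
  (1 + 'X^m) ^+ #|F| = 1 + 'X^(m * #|F|) :> {poly F}.
Proof.
have [p p_pr pcharF] := finPcharP F.
have charp : p \in [pchar {poly F}] by rewrite pchar_poly.
rewrite (card_pprimeChar pcharF); set n := (p ^ _)%N.
rewrite exprDn_pchar ?expr1n -?exprM //.
by rewrite (eq_pnat _ (pcharf_eq charp)) pnatX pnat_id.
Qed.

Lemma dvdXn_mul (F : fieldType) (a b : nat) (p q : {poly F}) :
  'X^(a + b) %| p * q -> 'X^a %| p \/ 'X^b %| q.
Proof.
have [->|p0] := eqVneq p 0; first by left; rewrite dvdp0.
have [->|q0] := eqVneq q 0; first by right; rewrite dvdp0.
have -> : 'X = 'X - 0%:P :> {poly F} by rewrite subr0.
rewrite -!mup_geq ?mulf_neq0 // mupM // => le.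
case: (leqP a (mup 0 p)) => [|lta]; first by left.
case: (leqP b (mup 0 q)) => [|ltb]; first by right.
by move: le; rewrite leqNgt -addSn leq_add // ltnW.
Qed.

Lemma natr_card (F : finFieldType) : #|F|%:R = 0 :> F.
Proof.
have [p p_pr pcharF] := finPcharP F.
have : #|F| = (p ^ logn p #|F|)%N := card_pprimeChar pcharF.
have := finNzRing_gt1 F; move: (logn p #|F|) => k gt1 cF; move: gt1; rewrite cF natrX.
by rewrite (pcharf0 pcharF) expr0n; case: k {cF} => //; rewrite expn0.
Qed.

(* y is a point of the affine curve (1, t, ..., (1 + t^m)^(1/m), ...), with a
   choice of roots, on the hyperplane orthogonal to xi. *)
Definition on_section (F : fieldType) (d : nat) (xi : 'I_d -> F) (t : F) :=
  exists y : 'I_d -> F,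
    [/\ forall m : 'I_d, m = 0%N :> nat -> y m = 1,
        forall m : 'I_d, m = 1%N :> nat -> y m = t,
        forall m : 'I_d, (1 < m)%N -> y m ^+ m = 1 + t ^+ m
      & \sum_m xi m * y m = 0].

(** A substitute for the norm of the linear form: a polynomial c in X of bounded degree that is a
    multiple of the form in the ring generated by the roots. It vanishes at every t in S whichever
    roots are chosen, and independence makes it nonzero. *)
Lemma hyperplane_section_bound (d : nat) : (2 <= d)%N -> exists K C : nat,
  forall F : finFieldType, large_char F K ->
  forall xi : 'I_d -> F, (exists m, xi m != 0) ->
  forall S : {set F}, (forall t, t \in S -> on_section xi t) -> (#|S| <= C)%N.
Proof.
move=> d2; pose E (m : 'I_d) := m.-1; pose b := (\sum_(m < d) m)%N.
(* With n monomials there are n + 1 unknowns of size C and n equations of size C + d, so n d < C is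
   needed. As a bound on the size of c, C also bounds the number of its roots. *)
pose C := (#|exponents E| * d).+1.
pose A2 := [set m : 'I_d | m != 1 :> nat].
pose N1 := (2 ^ #|[set: exponents E]| * (C + b))%N.
pose T1 := (N1 + #|[set: exponents E]|)%N.
pose N2 := (2 ^ #|A2| * (2 + b))%N; pose T2 := (N2 + #|A2|)%N.
exists (2 * d + (T1 + T2) + d * N1.+1 + d * N2.+1)%N, C => F char0 xi [mxi xi0] S HS.
have char2d : large_char F (2 * d) by apply: large_charW char0; lia.
have charN1 : large_char F (d * N1.+1) by apply: large_charW char0; lia.
have charN2 : large_char F (d * N2.+1) by apply: large_charW char0; lia.
have leT : (T1 + T2 <= #|F|)%N by have := large_char_card char0; lia.
have le_e (m : 'I_d) : ((E m).+1 <= d)%N by have := ltn_ord m; rewrite /E; lia.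
have leE (N : nat) (m : 'I_d) : ((E m).+1 * N.+1 <= d * N.+1)%N by rewrite leq_mul2r le_e orbT.
have E0 (m : 'I_d) : m = 0%N :> nat -> E m = 0%N by rewrite /E => ->.
have E1 (m : 'I_d) : (m < 2)%N -> E m = 0%N by rewrite /E; lia.
(* kappa m inverts E m + 1 modulo q, so (1 + X^m) ^ kappa m is an (E m + 1)-th
   root of 1 + X^m modulo X^q. *)
have [kappa kappaP] : exists kappa : 'I_d -> nat, forall m,
    exists t, ((E m).+1 * kappa m = (t * #|F|).+1)%N.
  apply: (@fin_all_exists _ (fun _ => nat) (fun m k => exists t, ((E m).+1 * k = (t * #|F|).+1)%N)) => m.
  have /coprimeP : coprime (E m).+1 #|F|.
    have [p p_pr pcharF] := finPcharP F.
    rewrite (card_pprimeChar pcharF) coprimeXr // coprime_sym prime_coprime //.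
    rewrite (dvdn_pcharf pcharF) char2d // ltnS leq0n (leq_trans (le_e m)) //.
    by rewrite leq_pmull.
  case=> // -[u v] /= uv; exists u, v; lia.
have kappa1 m : (E m).+1%:R * (kappa m)%:R = 1 :> F.
  have [t Ht] := kappaP m; rewrite -natrM Ht -addn1 natrD natrM.
  by rewrite natr_card mulr0 add0r.
pose g (t : {poly F}) (m : 'I_d) : {poly F} :=
  if m == 0%N :> nat then 1 else if m == 1%N :> nat then t else 1 + t ^+ m.
pose Y (m : 'I_d) : {poly F} := if (m < 2)%N then g 'X m else (1 + 'X^m) ^+ kappa m.
have Yg m : 'X^#|F| %| Y m ^+ (E m).+1 - g 'X m.
  rewrite /Y; case: ltnP => lem; first by rewrite E1 // expr1 subrr dvdp0.
  have [t Ht] := kappaP m; rewrite -exprM mulnC Ht exprS mulnC exprM oneD_Xn_exp_card.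
  rewrite /g !gtn_eqF ?(leq_trans _ lem) // -[X in _ - X]mulr1 -mulrBr dvdp_mull //.
  rewrite -[X in _ - X](expr1n _ t) subrXX dvdp_mulr // [1 + _]addrC addrK dvdp_exp2l //.
  by rewrite leq_pmull // (leq_trans _ lem).
have monE (a : exponents E) : monomial Y a = \prod_(m < d) (1 + 'X^m) ^+ (a m * kappa m).
  apply: eq_bigr => m _; rewrite /Y; case: ltnP => lem; last by rewrite -exprM mulnC.
  have : (a m <= 0)%N by rewrite -(E1 m lem) leq_ord.
  by rewrite leqn0 => /eqP->.
have indep_mon (h : exponents E -> {poly F}) : (forall a, size (h a) <= C)%N ->
    'X^T1 %| \sum_a h a * monomial Y a -> forall a, h a = 0.
  move=> sh dvdT a.
  apply: (@binomial_independence d F _ (fun (a : exponents E) m => a m * kappa m)%N [set: _] C T1) => //.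
  - by rewrite (leq_trans _ d2).
  - move=> a1 a2 _ _ ne.
    apply: (distinguishable_exponents E0 (or_introl erefl) kappa1 charN1 (leE _)) => [m|m|].
    + exact: leq_ord.
    + exact: leq_ord.
    apply: contra ne => /forallP eqa; apply/eqP/ffunP => m; apply/val_inj/eqP/eqa.
  - by move: dvdT; under eq_bigr do rewrite monE; under [in X in _ -> X]eq_bigl do rewrite inE.
(* Y_0 = 1 and Y_1 = X are dependent over F[X]. Index 1 is therefore dropped and its term absorbed
   into the coefficient xi_0 + xi_1 X of Y_0, whence the size bound 2. *)
have indep_lin : ~ 'X^T2 %| \sum_m (xi m)%:P * Y m.
  pose i0 : 'I_d := Ordinal (ltnW d2); pose i1 : 'I_d := Ordinal d2.
  pose a (i m : 'I_d) : nat := ((1 < i)%N && (i == m)).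
  pose W i : {poly F} := \prod_(m < d) (1 + 'X^m) ^+ (a i m * kappa m).
  pose r (i : 'I_d) : {poly F} := (xi i)%:P + (if i == i0 then (xi i1)%:P * 'X else 0).
  have WE i : i != i1 -> W i = Y i.
    move=> nei; rewrite /W /Y; case: ltnP => lei; last first.
      rewrite (bigD1 i) //= big1 => [|m]; rewrite /a lei /=; last first.
        by rewrite eq_sym => /negbTE->; rewrite mul0n expr0.
      by rewrite eqxx mul1n mulr1.
    rewrite big1 => [|m _]; last by rewrite /a ltnNge -ltnS lei mul0n expr0.
    have : i != 1%N :> nat by apply: contra nei => /eqP i1E; apply/eqP/val_inj.
    by rewrite /g; case: (nat_of_ord i) lei => [|[]].
  have iA2 i : (i \in A2) = (i != i1) by rewrite inE.
  move=> dvdT; have r0 : forall i, i \in A2 -> r i = 0.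
    apply: (@binomial_independence d F _ (fun i m => a i m * kappa m)%N A2 2 T2) => //.
    - by rewrite (leq_trans _ d2).
    - move=> j1 j2; rewrite !iA2 => A1 A2' ne.
      have aE (i m : 'I_d) : (a i m <= E m)%N.
        by rewrite /a; case: ltnP => //= lti; case: eqVneq => //= <-; rewrite /E; lia.
      apply: (distinguishable_exponents E0 (or_introl erefl) kappa1 charN2 (leE _)) => //.
      have ne1 (i : 'I_d) : i != i1 -> i != 1%N :> nat by [].
      move: (ne1 _ A1) (ne1 _ A2') => {ne1}B1 B2.
      rewrite negb_forall; apply/existsP; case: (ltnP 1 j1) => lt1.
        by exists j1; rewrite /a lt1 eqxx [j2 == j1]eq_sym (negbTE ne) andbF.
      exists j2; rewrite /a ltnNge lt1 /= eqxx andbT; case: ltnP => // lt2.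
      have := ne; rewrite -val_eqE /=; move: lt1 lt2 B1 B2.
      by case: (nat_of_ord j1) (nat_of_ord j2) => [|[]] // [|[]].
    - move=> i _; apply: leq_trans (size_polyD _ _) _; rewrite geq_max.
      rewrite (leq_trans (size_polyC_leq1 _)) //=; case: ifP => _; last by rewrite size_poly0.
      by rewrite mul_polyC (leq_trans (size_scale_leq _ _)) // size_polyX.
    move: dvdT; congr (_ %| _); rewrite (bigD1 i1) //=.
    under [RHS]eq_bigl do rewrite iA2.
    under [RHS]eq_bigr do rewrite -/(W _) mulrDl.
    rewrite big_split /= addrC; congr (_ + _).
      by apply: eq_bigr => i nei; rewrite WE.
    rewrite (bigD1 i0) //= ?eqxx big1 ?addr0 => [|i /andP[_ /negbTE->]]; last by rewrite mul0r.
    by rewrite WE // /Y /g /= mulr1.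
  move/negP: xi0; apply; case: (eqVneq mxi i1) => [->|ne1].
    have := r0 i0; rewrite iA2 /r eqxx => /(_ isT)/(congr1 (fun p : {poly F} => p`_1)).
    by rewrite coefD coefC coefCM coefX coef0 /= add0r mulr1 => ->.
  have := r0 mxi; rewrite iA2 ne1 /r => /(_ isT)/(congr1 (fun p : {poly F} => p`_0)).
  rewrite coefD coefC /= coef0; case: ifP => _; last by rewrite coef0 addr0 => ->.
  by rewrite coefCM coefX mulr0 addr0 => ->.
have sg (m : 'I_d) : (size (g 'X m) <= d)%N.
  have ltm := ltn_ord m; rewrite /g; case: eqP => _; first by rewrite size_poly1 ltnW.
  case: eqP => _; first by rewrite size_polyX.
  rewrite (leq_trans (size_polyD _ _)) // geq_max size_poly1 size_polyXn.
  by rewrite ltm ltnW.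
(* More unknowns than equations: a multiple of the linear form is a
   polynomial c in X alone, which vanishes at every t in S. *)
have [||||r [sr [o ro] rE]] := @poly_system_solution F (option (exponents E)) (exponents E) C (C + d)
   (fun r => multiplication_defect (g 'X) xi (fun a => r (Some a)) (r None)).
- move=> r s j; rewrite /multiplication_defect mulrnBl.
  set u := \sum_a _; set v := \sum_a _; set w := \sum_a _.
  have -> : u = v - w.
    rewrite /u /v /w -sumrB; apply: eq_bigr => a _; rewrite -sumrB.
    by apply: eq_bigr => m _; rewrite mulrBr mulrnBl.
  move: v w (r None *+ _) (s None *+ _) => v w x y; ring.
- move=> r s rs j; rewrite /multiplication_defect rs; congr (_ - _).
  by apply: eq_bigr => a _; apply: eq_bigr => m _; rewrite rs.
- move=> r sr j; rewrite /multiplication_defect.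
  have szn (x : {poly F}) (e : bool) : (size x <= C + d)%N -> (size (x *+ e)%R <= C + d)%N.
    by case: e; rewrite ?mulr1n // mulr0n size_poly0.
  have szs (J : finType) (f : J -> {poly F}) :
      (forall i, size (f i) <= C + d)%N -> (size (\sum_i f i)%R <= C + d)%N.
    move=> sf; elim/big_ind: _ => [|x y sx sy|i _] //; first by rewrite size_poly0.
    by rewrite (leq_trans (size_polyD _ _)) // geq_max sx.
  rewrite (leq_trans (size_polyD _ _)) // geq_max size_polyN; apply/andP; split; last first.
    by apply: szn; apply: leq_trans (sr _) (leq_addr _ _).
  apply: (szs) => a; apply: (szs) => m; apply: (szn).
  have sc : (size (carry (g 'X) m a) <= d)%N.
    by rewrite /carry; case: ifP => _ //; rewrite size_poly1 ltnW.
  have := size_mul_bound (size_mul_bound (size_polyC_leq1 (xi m)) sc) (sr (Some a)).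
  by move/leq_trans; apply; rewrite add1n /= addnC leq_pred.
- rewrite card_option /C mulnDr mulSn addnC ltn_add2r mulnC.
  by rewrite [(d * _)%N]mulnC ltnSn.
pose h a := r (Some a); pose c := r None.
have defect (p : {poly F}) (Z : 'I_d -> {poly F}) :
    (forall m, p %| Z m ^+ (E m).+1 - g 'X m) ->
    p %| (\sum_m (xi m)%:P * Z m) * (\sum_a h a * monomial Z a) - c.
  move=> Zg; have := multiplication_defectP Zg xi h c.
  by rewrite [X in _ - X]big1 ?subr0 // => j _; rewrite rE mul0r.
(* If c were 0, X^q would divide the product of the form and the cofactor. As q >= T1 + T2, one of
   them would vanish at 0 to an order that independence forbids. *)
have c0 : c != 0.
  apply/negP => /eqP c0; have := defect _ Y Yg; rewrite c0 subr0 => dvdq.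
  have : 'X^(T2 + T1) %| (\sum_m (xi m)%:P * Y m) * (\sum_a h a * monomial Y a).
    by apply: dvdp_trans dvdq; rewrite dvdp_exp2l // addnC.
  case/dvdXn_mul => [//|dvdh]; have h0 := indep_mon _ (fun a => sr (Some a)) dvdh.
  by case: o ro => [a|] /eqP[]; [exact: h0 | exact: c0].
(* The same congruence modulo X - t, with the constants y_m in place of the roots: there the linear
   form is 0. *)
have rootc t : t \in S -> root c t.
  move=> /HS[y [y0 y1 ym ysum]].
  have : 'X - t%:P %| (\sum_m (xi m)%:P * (y m)%:P) *
     (\sum_a h a * monomial (fun m => (y m)%:P) a) - c.
    apply: defect => m; rewrite dvdp_XsubCl rootE hornerD hornerN horner_exp hornerC /g.
    apply/eqP; case: eqP => [m0|m0]; first by rewrite y0 // expr1n hornerC subrr.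
    case: eqP => [m1|/eqP m1]; first by rewrite y1 // /E m1 expr1 hornerX subrr.
    have lt1 : (1 < m)%N by move: m0 m1; case: (nat_of_ord m) => [|[]].
    rewrite /E prednK ?(ltnW lt1) // !hornerE ym // subrr //.
  under eq_bigr do rewrite -polyCM.
  by rewrite -rmorph_sum /= ysum mul0r sub0r dvdpNr dvdp_XsubCl.
have := max_poly_roots c0 (rs := enum S).
rewrite -cardE enum_uniq; move=> lt; apply: ltnW; apply: leq_trans (lt _ isT) (sr None).
by apply/allP => t; rewrite mem_enum => /rootc.
Qed.

(** * Simultaneous power values, by Stepanov's method *)

Lemma expf_card_pred (F : finFieldType) (x : F) : x != 0 -> x ^+ #|F|.-1 = 1.
Proof.
move=> x0; apply: (mulfI x0); rewrite -exprS prednK ?expf_card ?mulr1 //.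
exact: ltnW (finNzRing_gt1 F).
Qed.

Lemma finField_primitive_root (F : finFieldType) : exists z : F, (#|F|.-1).-primitive_root z.
Proof.
have gt0 : (0 < #|F|.-1)%N by rewrite -subn1 subn_gt0 finNzRing_gt1.
have [||z _ pz] := hasP (@has_prim_root F _ [seq x <- enum F | x != 0] gt0 _ (filter_uniq _ (enum_uniq _)) _).
- by apply/allP => x; rewrite mem_filter => /andP[x0 _]; rewrite unity_rootE expf_card_pred.
- rewrite -(cardC1 (0 : F)) cardE (uniq_leq_size (enum_uniq _)) // => x.
  by rewrite mem_enum mem_filter mem_enum !inE andbT.
by exists z.
Qed.

Lemma power_of_expf_eq1 (F : finFieldType) (m : nat) (x : F) : (0 < m)%N -> x != 0 ->
  x ^+ (#|F|.-1 %/ gcdn m #|F|.-1) = 1 -> exists y, y ^+ m = x.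
Proof.
move=> m0 x0 xk; set n := #|F|.-1 in xk *.
have [z pz] := finField_primitive_root F; rewrite -/n in pz.
have [i xE] := prim_rootP pz (expf_card_pred x0).
have n0 : (0 < n)%N := prim_order_gt0 pz.
have e0 : (0 < gcdn m n)%N by rewrite gcdn_gt0 m0.
have : (gcdn m n %| i)%N.
  move: xk; rewrite xE -exprM => /eqP; rewrite -(prim_order_dvd pz).
  by rewrite -{1}(divnK (dvdn_gcdr m n)) mulnC dvdn_pmul2r // divn_gt0 // dvdn_leq // dvdn_gcdr.
case/dvdnP => i' iE; have [u v uv _] := egcdnP n m0.
exists (z ^+ (u * i')); rewrite xE -exprM mulnAC uv mulnDl exprD mulnAC mulnC exprM.
by rewrite (prim_expr_order pz) expr1n mul1r iE mulnC.
Qed.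

Section Theta.
Variables (F : fieldType) (P : {poly F}).
(** With [P] as multiplier, each application keeps a polynomial multiple of a product of binomial
    powers of that form. *)
Definition theta (R : {poly F}) : {poly F} := P * R^`().

Lemma iter_theta_sum (I : finType) (f : I -> {poly F}) n :
  iter n theta (\sum_i f i) = \sum_i iter n theta (f i).
Proof.
elim: n => [//|n IHn]; rewrite iterS IHn /theta raddf_sum mulr_sumr.
by apply: eq_bigr => i _; rewrite iterS.
Qed.

(** The value is n! P(t)^n S(t), so iterated first derivatives detect multiplicities below the
    characteristic. *)
Lemma iter_theta_XsubC (K : nat) (t : F) n (S : {poly F}) : large_char F K -> (n <= K)%N ->
  P.[t] != 0 -> S.[t] != 0 -> (iter n theta (('X - t%:P) ^+ n * S)).[t] != 0.
Proof.
move=> char0 + Pt; elim: n S => [|n IHn] S lt St; first by rewrite expr0 mul1r.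
rewrite iterSr.
have -> : theta (('X - t%:P) ^+ n.+1 * S) =
   ('X - t%:P) ^+ n * (n.+1%:R * P * S + ('X - t%:P) * P * S^`()).
  by rewrite /theta derivM deriv_exp derivXsubC mul1r /= -mulr_natl exprS; ring.
apply: IHn; first exact: ltnW.
rewrite !hornerE subrr !mul0r addr0 -polyC_natr hornerC !mulf_neq0 // char0 //.
Qed.

Lemma mup_theta (K M : nat) (t : F) (R : {poly F}) : large_char F K -> (M <= K)%N ->
  P.[t] != 0 -> R != 0 -> (forall l, (l < M)%N -> (iter l theta R).[t] = 0) ->
  (M <= mup t R)%N.
Proof.
move=> char0 MK Pt R0 Rt; rewrite leqNgt; apply/negP => ltM.
have [n [S]] := multiplicity_XsubC R t; rewrite R0 /= => St RE.
have nE : mup t R = n by rewrite RE mupMr // mup_XsubCX eqxx.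
rewrite nE in ltM.
have /negP[] := iter_theta_XsubC char0 (leq_trans (ltnW ltM) MK) Pt St.
by rewrite mulrC -RE Rt.
Qed.
End Theta.

Lemma sum_mup_size (F : finFieldType) (M : nat) (S : {set F}) (R : {poly F}) : R != 0 ->
  (forall t, t \in S -> M <= mup t R)%N -> (M * #|S| < size R)%N.
Proof.
move=> R0 HS; rewrite cardE.
have : all (fun t => ('X - t%:P) ^+ M %| R) (enum S).
  by apply/allP => t; rewrite mem_enum => /HS; rewrite mup_geq.
have := enum_uniq (mem S); move: (enum S) => s us Hs.
have [] : \prod_(t <- s) ('X - t%:P) ^+ M %| R /\
   size (\prod_(t <- s) ('X - t%:P) ^+ M) = (M * size s).+1.
  elim: s us Hs => [|t s IHs] /=; first by rewrite big_nil dvd1p size_poly1 muln0.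
  case/andP=> ts us /andP[Ht Hs]; have [IH1 IH2] := IHs us Hs.
  rewrite big_cons; split.
    rewrite Gauss_dvdp ?Ht //; apply: coprimep_expl; rewrite coprimep_sym coprimep_XsubC.
    rewrite /root horner_prod; elim: s ts {us Hs IHs IH1 IH2} => [|x s IHs].
      by rewrite big_nil oner_neq0.
    rewrite inE negb_or big_cons => /andP[ntx nts]; rewrite mulf_neq0 ?IHs //.
    by rewrite horner_exp expf_neq0 // !hornerE subr_eq0.
  rewrite size_mul ?expf_neq0 ?polyXsubC_eq0 // -?size_poly_gt0 ?IH2 //.
  by rewrite size_exp_XsubC mulnS addSn /= addnS.
move=> dv <-; exact: dvdp_leq.
Qed.

Section Stepanov.
Variables (F : finFieldType) (d : nat).
Hypothesis d2 : (2 <= d)%N.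
Local Notation q := #|F|.
Local Notation b := (\sum_(m < d) m)%N.

(* gcd(m, q-1) - 1, except at m = 0 where gcdn would give q - 2. *)
Definition power_index (m : 'I_d) : nat :=
  if m == 0%N :> nat then 0%N else (gcdn m q.-1).-1.
(** For m > 0 and 1 + t^m nonzero, raising 1 + t^m to this power gives 1 exactly when it is an m-th
    power in F. *)
Definition cofactor_exponent (m : 'I_d) : nat := (q.-1 %/ (power_index m).+1)%N.

Local Notation E := power_index.
Local Notation kappa := cofactor_exponent.
Local Notation P := (\prod_(m < d) (1 + 'X^m) : {poly F}).
Let u (m : 'I_d) : {poly F} := (1 + 'X^m) ^+ kappa m.
Local Notation mon := (@monomial d E {poly F} u).

Lemma power_index_mul (m : 'I_d) : ((E m).+1 * kappa m = q.-1)%N.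
Proof.
have q1 : (0 < q.-1)%N by rewrite -subn1 subn_gt0 finNzRing_gt1.
rewrite mulnC divnK // /E; case: eqP => // /eqP m0.
by rewrite prednK ?dvdn_gcdr // gcdn_gt0 lt0n m0.
Qed.

Lemma power_index_le (m : 'I_d) : ((E m).+1 <= d)%N.
Proof.
rewrite /E; case: eqP => [_|/eqP]; first by apply: leq_trans d2.
rewrite -lt0n => m0; rewrite prednK ?gcdn_gt0 ?m0 //.
by rewrite (leq_trans (dvdn_leq m0 (dvdn_gcdl _ _))) // ltnW.
Qed.

Lemma monE (a : exponents E) : mon a = \prod_(m < d) (1 + 'X^m) ^+ (a m * kappa m).
Proof. by apply: eq_bigr => m _; rewrite /u -exprM mulnC. Qed.

Lemma one_plus_Xn_size (m : 'I_d) : (size (1 + 'X^m : {poly F})%R <= m.+1)%N.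
Proof. by rewrite (leq_trans (size_polyD _ _)) // geq_max size_poly1 size_polyXn leqnn. Qed.

Lemma stepanov_size_P : (size P <= b.+1)%N.
Proof.
elim: (index_enum 'I_d) => [|j s IHs]; first by rewrite !big_nil size_poly1.
by rewrite !big_cons; apply: leq_trans (size_mul_bound (one_plus_Xn_size j) IHs) _; rewrite addSn /= addnS.
Qed.

(** Each u_m(t) is a root of unity of order dividing E m + 1. Multiplication by it only shifts the
    exponents cyclically, so the sum is fixed by a scalar different from 1. *)
Lemma sum_monomial_eval0 (t : F) (m : 'I_d) : P.[t] != 0 -> (u m).[t] != 1 ->
  \sum_(a : exponents E) (mon a).[t] = 0.
Proof.
move=> Pt um.
have ue m' : 'X - t%:P %| u m' ^+ (E m').+1 - 1.
  rewrite dvdp_XsubCl rootE hornerD hornerN hornerC horner_exp /u horner_exp.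
  rewrite -exprM mulnC power_index_mul expf_card_pred ?subrr //.
  by apply: contraNneq Pt => H; rewrite horner_prod (bigD1 m') //= H mul0r.
have step a : (u m).[t] * (mon a).[t] = (mon (exponents_succ m a)).[t].
  have := monomial_succ ue m a; rewrite dvdp_XsubCl rootE hornerD hornerN hornerM => /eqP/subr0_eq->.
  by rewrite /carry if_same mul1r.
set s := \sum_a _; have us : (u m).[t] * s = s.
  rewrite mulr_sumr; under eq_bigr do rewrite step.
  rewrite /s [RHS](reindex_inj (h := exponents_succ m)) //=.
  move=> a1 a2 /ffunP eqa; apply/ffunP => i; have := eqa i; rewrite !ffunE.
  by case: eqP => // _ /ordS_inj.
apply/eqP; have /eqP : ((u m).[t] - 1) * s = 0 by rewrite mulrBl us mul1r subrr.
by rewrite mulf_eq0 subr_eq0 (negbTE um).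
Qed.

(* R = sum r_(a,j) u^a X^(q j): X^(q j) is a constant of the derivation and takes
   the value t^j on F. Where some u_m(t) <> 1 the values of the u^a sum to 0, so it
   is enough that the coefficient of u^a in each derivative be independent of a. *)
Lemma stepanov_auxiliary (K M J B : nat) :
    let n := #|exponents E| in let N := (2 ^ n * (B + b))%N in
    large_char F K -> (2 * d <= K)%N -> (d * N.+1 <= K)%N -> (N + n <= q)%N ->
    (n.-1 * M * (B + M * b + J) < n * J * B)%N ->
  exists R : {poly F}, [/\ R != 0, (size R <= B + q * (b + J))%N &
    forall t m l, P.[t] != 0 -> (u m).[t] != 1 -> (l < M)%N -> (iter l (theta P) R).[t] = 0].
Proof.
move=> n N char0 leK1 leK2 leq_q lt.
have [l sl PW] := fin_all_exists2 (fun a : exponents E =>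
  deriv_prod_powers (index_enum 'I_d) (fun m => a m * kappa m)%N one_plus_Xn_size).
pose Th a (r : {poly F}) : {poly F} := P * r^`() + l a * r.
have ThB a k (r s : {poly F}) : iter k (Th a) (r - s) = iter k (Th a) r - iter k (Th a) s.
  by elim: k => //= k ->; rewrite /Th derivB; ring.
have sTh a k (r : {poly F}) : (size r <= B)%N -> (size (iter k (Th a) r) <= B + k * b)%N.
  move=> sr; elim: k => [|k IHk] /=; first by rewrite addn0.
  rewrite /Th (leq_trans (size_polyD _ _)) // geq_max; apply/andP; split.
    have := size_mul_bound stepanov_size_P (leq_trans (size_deriv_leq _) (leq_trans (leq_pred _) IHk)).
    by move/leq_trans; apply; rewrite addSn /= mulSn addnCA.
  have := size_mul_bound (sl a) IHk; move/leq_trans; apply.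
  by rewrite mulSn addnCA leq_pred.
have dXq j : ('X^(q * j) : {poly F})^`() = 0.
  rewrite derivXn -mulr_natr natrM.
  by rewrite -[q%:R]polyC_natr natr_card mul0r mulr0.
have thE k a j r : iter k (theta P) (r * mon a * 'X^(q * j)) = iter k (Th a) r * mon a * 'X^(q * j).
  elim: k => //= k ->; rewrite /theta /Th derivM dXq mulr0 addr0 derivM.
  rewrite mulrDl mulrDr mulrDl mulrDl.
  have -> : P * (iter k (Th a) r * (mon a)^`() * 'X^(q * j)) =
     iter k (Th a) r * 'X^(q * j) * (P * (mon a)^`()) by ring.
  have -> : P * (mon a)^`() = l a * mon a by rewrite monE PW.
  by ring.
pose a0 := exponents0 E.
(* The coefficient of the monomial [a] in the k-th iterate, with X^(q j) replaced by X^j, which has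
   the same values on F. *)
pose c (r : exponents E * 'I_J -> {poly F}) a k := \sum_(j < J) iter k (Th a) (r (a, j)) * 'X^j.
have cB r s a k : c (fun i => r i - s i) a k = c r a k - c s a k.
  by rewrite /c -sumrB; apply: eq_bigr => j _; rewrite ThB mulrBl.
have sc (r : exponents E * 'I_J -> {poly F}) a k : (forall i, size (r i) <= B)%N -> (k < M)%N -> (size (c r a k) <= B + M * b + J)%N.
  move=> sr ltk; rewrite /c; elim/big_ind: _ => [|x y sx sy|j _]; first by rewrite size_poly0.
    by rewrite (leq_trans (size_polyD _ _)) // geq_max sx.
  have sX : (size ('X^j : {poly F}) <= J)%N by rewrite size_polyXn.
  apply: leq_trans (size_mul_bound (sTh a k _ (sr (a, j))) sX) _.
  by rewrite (leq_trans (leq_pred _)) // leq_add2r leq_add2l leq_mul2r ltnW ?orbT.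
(* Equality with the coefficient at [a0] is imposed for the other n - 1 monomials and for k < M: (n
   - 1) M equations of size B + M b + J in n J unknowns of size B. *)
have [||||r [sr [o ro] rE]] := @poly_system_solution F (exponents E * 'I_J)%type
   ({a : exponents E | a != a0} * 'I_M)%type B (B + M * b + J)
   (fun r i => c r (val i.1) i.2 - c r a0 i.2).
- move=> r s [i k] /=; rewrite !cB; ring.
- move=> r s rs [i k] /=; rewrite /c; congr (_ - _); apply: eq_bigr => j _; rewrite rs //.
- move=> r sr [i k] /=; rewrite (leq_trans (size_polyD _ _)) // geq_max size_polyN.
  by rewrite !sc.
- rewrite !card_prod !card_ord card_sig.
  by have := cardC1 a0; rewrite -/n => ->.
have cE a k : (k < M)%N -> c r a k = c r a0 k.
  move=> ltk; have [->//|ne] := eqVneq a a0.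
  by have /= := rE (exist _ a ne, Ordinal ltk) => /subr0_eq.
pose R := \sum_(i : exponents E * 'I_J) r i * mon i.1 * 'X^(q * i.2).
exists R; split.
- apply/eqP => R0; move/negP: ro; apply; apply/eqP.
  have RE : \sum_(j < J) (\sum_a r (a, j) * mon a) * 'X^(q * j) = 0.
    rewrite -[RHS]R0 /R; under eq_bigr do rewrite mulr_suml.
    by rewrite exchange_big pair_bigA /=; apply: eq_bigr => -[a j].
  (* Once the coefficients below j vanish, every term of R other than the j-th is divisible by X^(q
     (j + 1)). So X^q divides the j-th inner sum, and independence applies with T = q. *)
  suff H k (j : 'I_J) : (j < k)%N -> forall a, r (a, j) = 0 by case: o => a j; exact: H (ltnSn j) a.
  elim: k j => [//|k IHk] j ltj a.
  have dvdq : 'X^q %| \sum_a r (a, j) * mon a.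
    rewrite -(@dvdp_mul2r _ 'X^(q * j)) ?monic_neq0 ?monicXn // -exprD -mulnS.
    have -> : (\sum_a r (a, j) * mon a) * 'X^(q * j) =
       - \sum_(i | i != j) (\sum_a r (a, i) * mon a) * 'X^(q * i).
      by move: RE; rewrite (bigD1 j) //= => /eqP; rewrite addr_eq0 => /eqP.
    rewrite dvdpNr; elim/big_ind: _ => [|x y|i nei]; rewrite ?dvdp0 //; first exact: dvdp_add.
    case: (ltngtP i j) => [lt_ij|lt_ji|/val_inj eij]; last by rewrite eij eqxx in nei.
      rewrite big1 ?mul0r ?dvdp0 // => a' _; rewrite IHk ?mul0r //.
      by apply: leq_trans lt_ij _.
    by rewrite dvdp_mull // dvdp_exp2l // leq_mul2l lt_ji orbT.
  apply: (@binomial_independence d F _ (fun (a : exponents E) m => a m * kappa m)%N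
            [set: _] B q (fun a => r (a, j))) => //.
  + by apply: leq_trans d2.
  + exact: large_charW leK1 char0.
  + move=> a1 a2 _ _ ne; rewrite cardsT.
    have E0 (m : 'I_d) : m = 0%N :> nat -> E m = 0%N by rewrite /power_index => ->.
    have kE m : (E m).+1%:R * (kappa m)%:R = -1 :> F.
      apply/eqP; rewrite -addr_eq0 -natrM power_index_mul natr1 prednK ?natr_card //.
      exact: ltnW (finNzRing_gt1 F).
    have leE m : ((E m).+1 * N.+1 <= K)%N.
      by apply: leq_trans leK2; rewrite leq_mul2r power_index_le orbT.
    apply: (distinguishable_exponents E0 (or_intror erefl) kE char0 leE) => [m|m|].
    * exact: leq_ord.
    * exact: leq_ord.
    by apply: contra ne => /forallP eqa; apply/eqP/ffunP => m; apply/val_inj/eqP/eqa.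
  + by rewrite cardsT.
  + by move: dvdq; under eq_bigr do rewrite monE; under [in X in _ -> X]eq_bigl do rewrite inE.
- rewrite /R; elim/big_ind: _ => [|x y sx sy|[a j] _]; first by rewrite size_poly0.
    by rewrite (leq_trans (size_polyD _ _)) // geq_max sx.
  have smon : (size (mon a) <= (q * b).+1)%N.
    rewrite monE big_distrr /=; elim: (index_enum 'I_d) => [|m s IHs]; first by rewrite !big_nil size_poly1.
    have sp : (size ((1 + 'X^m) ^+ (a m * kappa m) : {poly F})%R <= (q * m).+1)%N.
      apply: leq_trans (size_poly_exp_leq _ _) _; rewrite ltnS mulnC leq_mul //.
        apply: leq_trans (leq_pred q); rewrite -(power_index_mul m).
        by rewrite leq_mul2r (leq_trans (leq_ord _) (leqnSn _)) orbT.
      by rewrite -ltnS; case: size (one_plus_Xn_size m) => [|k].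
    by rewrite !big_cons; apply: leq_trans (size_mul_bound sp IHs) _; rewrite addSn /= addnS.
  have sX : (size ('X^(q * j) : {poly F}) <= (q * j).+1)%N by rewrite size_polyXn.
  apply: leq_trans (size_mul_bound (size_mul_bound (sr (a, j)) smon) sX) _.
  by rewrite !addnS /= mulnDr addnA leq_add2l leq_mul2l ltnW ?orbT.
move=> t m k Pt um ltk; rewrite /R iter_theta_sum.
under eq_bigr => i _ do rewrite thE.
rewrite horner_sum; transitivity (\sum_a (mon a).[t] * (c r a k).[t]).
  transitivity (\sum_a \sum_(j < J) (iter k (Th a) (r (a, j)) * mon a * 'X^(q * j)).[t]).
    by rewrite pair_bigA /=; apply: eq_bigr => -[a j].
  apply: eq_bigr => a _; rewrite /c horner_sum mulr_sumr; apply: eq_bigr => j _.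
  by rewrite !hornerM !hornerXn exprM expf_card; ring.
under eq_bigr do rewrite cE //.
by rewrite -mulr_suml (sum_monomial_eval0 Pt um) mul0r.
Qed.
End Stepanov.

Definition simultaneous_powers (F : finFieldType) (d : nat) : {set F} :=
  [set t | [forall m : 'I_d, (1 < m)%N ==> [exists y : F, y ^+ m == 1 + t ^+ m]]].

Lemma simultaneous_powers_lower_bound (d : nat) : (2 <= d)%N -> exists K M : nat,
  forall F : finFieldType, large_char F K -> (#|F| <= M * #|simultaneous_powers F d|)%N.
Proof.
(* The linear system is solvable because n J - (n - 1) M >= A0 * mm, and the
   degree gain mm - b = 2 makes M * #|bad| smaller than (M - 1) q. *)
move=> d2; pose b := (\sum_(m < d) m)%N; pose A0 := (\prod_(m < d) (m.-1).+1)%N.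
pose mm := (b + 2)%N; pose M := (2 * A0 * mm)%N; pose J := (M - mm)%N.
(* The surplus A0 mm B has to exceed (n - 1) M (M b + J). Since M = 2 A0 mm, it suffices that B > 2
   (n - 1) (M b + J). *)
pose B := (2 * A0 * (M * b + J)).+1; pose N := (2 ^ A0 * (B + b))%N.
pose K := (2 * d + d * N.+1 + (N + A0) + (B + M * b) + M)%N.
have [K1 K2 K3 K4 K5] : [/\ (2 * d <= K)%N, (d * N.+1 <= K)%N, (N + A0 <= K)%N, (B + M * b <= K)%N & (M <= K)%N].
  rewrite /K; move: (2 * d)%N (d * N.+1)%N (N + A0)%N (B + M * b)%N (M) => v x y z w; split; lia.
exists K, M => F char0.
have A0_gt0 : (0 < A0)%N by apply: prodn_gt0.
pose n := #|exponents (@power_index F d)|.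
have nE : n = (\prod_(m < d) (power_index F m).+1)%N by rewrite /n card_exponents.
have n_gt0 : (0 < n)%N by rewrite nE; apply: prodn_gt0.
have leA0 : (n <= A0)%N.
  rewrite nE; apply: leq_prod => m _; rewrite ltnS /power_index; case: eqP => // /eqP m0.
  by rewrite -!subn1 leq_sub2r // dvdn_leq ?lt0n // dvdn_gcdl.
have le_q : (K < #|F|)%N := large_char_card char0.
have leN : (2 ^ n * (B + b) <= N)%N by rewrite leq_mul2r leq_exp2l // leA0 orbT.
have lt : (n.-1 * M * (B + M * b + J) < n * J * B)%N.
  have ME : (M = J + mm)%N by rewrite subnK // /M -{1}[mm]mul1n leq_mul2r muln_gt0 A0_gt0 orbT.
  have JE : (J = (2 * A0).-1 * mm)%N by rewrite -subn1 mulnBl mul1n.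
  have mm_gt0 : (0 < mm)%N by rewrite /mm addn2.
  rewrite -addnA /B; move: (M * b + J)%N => X; rewrite JE /M.
  rewrite -(subnKC leA0) -(prednK n_gt0) succnK; move: n.-1 (A0 - n.-1.+1)%N (mm) mm_gt0 => n' w k k_gt0.
  have -> : (2 * (n'.+1 + w)).-1 = (n'.+1 + n' + w + w)%N by lia.
  apply: (@leq_trans (n' * (2 * (n'.+1 + w) * k) * ((2 * (n'.+1 + w) * X).+1 + X)
     + k * (2 * (n'.+1 + w) * X * (1 + 2 * w) + n'.+1 + w + w))%N).
    by rewrite -addn1 leq_add2l muln_gt0 k_gt0 /= addn_gt0 addn_gt0 addnS.
  by apply/eq_leq; ring.
have [||||R [R0 sR Rt]] := @stepanov_auxiliary F d d2 K M J B char0.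
- exact: K1.
- apply: (@leq_trans (d * N.+1)); first by rewrite leq_mul2l ltnS leN orbT.
  exact: K2.
- apply: leq_trans (ltnW le_q); apply: (@leq_trans (N + A0)); first by rewrite leq_add.
  exact: K3.
- exact: lt.
pose P := \prod_(m < d) (1 + 'X^m) : {poly F}.
pose bad := [set t | (P.[t] != 0) && [exists m : 'I_d, ((1 + 'X^m) ^+ cofactor_exponent F m : {poly F}).[t] != 1]].
have sbad : (M * #|bad| < B + #|F| * (b + J))%N.
  apply: leq_trans sR; apply: sum_mup_size => // t; rewrite inE => /andP[Pt /existsP[m um]].
  by apply: (mup_theta char0 _ Pt R0) => [|l ltl]; [exact: K5|exact: Rt um ltl].
pose Z := [set t | P.[t] == 0].
have sZ : (#|Z| <= b)%N.
  have P0 : P != 0.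
    apply/eqP => /(congr1 (horner^~ 0)); rewrite /P horner_prod horner0 => /eqP.
    apply/negP; elim/big_ind: _ => [|x y|m _]; rewrite ?oner_neq0 //; first exact: mulf_neq0.
    rewrite !hornerE expr0n; case: (nat_of_ord m == 0%N); rewrite ?addr0 ?oner_neq0 //.
    by apply: (char0 2); rewrite /= (leq_trans _ K1) // leq_pmulr // ltnW.
  have := max_poly_roots P0 (rs := enum Z); rewrite enum_uniq -cardE.
  have -> : all (root P) (enum Z) by apply/allP => t; rewrite mem_enum inE.
  by move=> /(_ isT isT) ltZ; rewrite -ltnS (leq_trans ltZ) // stepanov_size_P.
(* Away from the zeros of P, if every u_m(t) is 1 then every 1 + t^m is an m-th power. *)
have cover : (#|F| <= #|simultaneous_powers F d| + #|bad| + #|Z|)%N.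
  rewrite -cardsT; apply: (@leq_trans #|simultaneous_powers F d :|: bad :|: Z|).
    apply/subset_leq_card/subsetP => t _; rewrite !inE.
    case: eqVneq => [|Pt]; first by rewrite orbT.
    rewrite orbF /=; case: existsP => [|bad_t]; first by rewrite orbT.
    rewrite orbF; apply/forallP => m; apply/implyP => m1.
    have um : (1 + t ^+ m) ^+ cofactor_exponent F m = 1.
      apply/eqP/negPn/negP => um; apply: bad_t; exists m.
      by rewrite horner_exp !hornerE.
    have tm : 1 + t ^+ m != 0.
      by apply: contraNneq Pt => tm; rewrite horner_prod (bigD1 m) //= !hornerE tm mul0r.
    have [||y yE] := @power_of_expf_eq1 F m _ _ tm; first exact: ltnW.
      rewrite -[RHS]um; congr (_ ^+ _); rewrite /cofactor_exponent /power_index gtn_eqF ?(ltnW m1) //.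
      by rewrite prednK // gcdn_gt0 ltnW.
    by apply/existsP; exists y; rewrite yE.
  apply: leq_trans (leq_card_setU _ _).1 _; rewrite leq_add2r; exact: (leq_card_setU _ _).1.
have ME : (M = J + mm)%N by rewrite subnK // /M -{1}[mm]mul1n leq_mul2r muln_gt0 A0_gt0 orbT.
have le_q' : (B + M * b <= #|F|)%N by apply: leq_trans K4 (ltnW le_q).
have coverM : (M * #|F| <= M * (#|simultaneous_powers F d| + #|bad| + #|Z|))%N by rewrite leq_mul2l cover orbT.
have sZM : (M * #|Z| <= M * b)%N by rewrite leq_mul2l sZ orbT.
have ME' : (M * #|F| = J * #|F| + b * #|F| + 2 * #|F|)%N by rewrite {1}ME /mm !mulnDl addnA.
(* Since b + J = M - 2, the inequalities give 2q < M |G| + B + M b, with G the set of good t, and B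
   + M b <= q leaves q <= M |G|. *)
move: coverM sbad sZM le_q' ME'; rewrite !mulnDr [(#|F| * b)%N]mulnC [(#|F| * J)%N]mulnC.
move: (M * #|F|)%N (M * #|bad|)%N (M * #|Z|)%N (M * b)%N (b * #|F|)%N (J * #|F|)%N #|F| (M * #|_|)%N.
clearbody B; clear; move=> a1 a2 a3 a4 a5 a6 a7 a8; lia.
Qed.

(** * Counting points of the variety *)

Definition dot (F : fieldType) (d : nat) (x y : 'rV[F]_d) : F := \sum_m x 0 m * y 0 m.

Section Variety.
Variables (F : finFieldType) (d : nat).
Hypothesis d3 : (3 <= d)%N.
Local Notation V := (H2set F d).
Let i0 : 'I_d := Ordinal (ltnW (ltnW d3)).
Let i1 : 'I_d := Ordinal (ltnW d3).

Lemma coordE (x : 'rV[F]_d) (m : 'I_d) : Defs.coord x m = x 0 m.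
Proof. by rewrite /Defs.coord valK. Qed.

Lemma mem_H2set (x : 'rV[F]_d) : reflect
  (forall m : 'I_d, (1 < m)%N -> x 0 m ^+ m = x 0 i0 ^+ m + x 0 i1 ^+ m) (x \in V).
Proof.
rewrite inE; apply: (iffP forallP) => [H m m1|H j].
  have ltj : (m.-1 < d)%N by rewrite (leq_ltn_trans (leq_pred m)).
  have := H (Ordinal ltj) => /=; rewrite !(prednK (ltnW m1)).
  have -> : (0 < m.-1)%N && (m.-1 <= d - 2)%N by have := ltn_ord m; lia.
  rewrite (coordE x i0) (coordE x i1) coordE => /eqP/subr0_eq/esym; exact.
apply/implyP => /andP[j0 jd].
have ltj : (j.+1 < d)%N by lia.
have := H (Ordinal ltj) j0 => /= E.
by rewrite (coordE x i0) (coordE x i1) (coordE x (Ordinal ltj)) E subrr.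
Qed.

Lemma H2set_scale (c : F) (x : 'rV[F]_d) : x \in V -> c *: x \in V.
Proof.
move=> /mem_H2set H; apply/mem_H2set => m m1; rewrite !mxE !exprMn H // mulrDr //.
Qed.

Lemma card_H2set_fiber (a b : F) :
  (#|[set x in V | ((x 0 i0 == a) && (x 0 i1 == b))%R]| <= d ^ d)%N.
Proof.
pose Rt (m : 'I_d) : {set F} := if (1 < m)%N then [set z | z ^+ m == a ^+ m + b ^+ m]
  else if m == i0 then [set a] else [set b].
have sR m : (#|Rt m| <= d)%N.
  rewrite /Rt; case: ifP => [m1|_]; last by case: ifP; rewrite cards1 (leq_trans _ d3).
  have szp := @size_XnsubC F m (a ^+ m + b ^+ m) (ltnW m1).
  have p0 : 'X^m - (a ^+ m + b ^+ m)%:P != 0 :> {poly F} by rewrite -size_poly_gt0 szp.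
  set Rm := [set z | _]; have : (size (enum Rm) < m.+1)%N.
    rewrite -szp; apply: max_poly_roots p0 _ (enum_uniq _).
    by apply/allP => z; rewrite mem_enum inE rootE !hornerE subr_eq0.
  by rewrite -cardE ltnS => /leq_trans; apply; apply: ltnW.
pose f (x : 'rV[F]_d) : {ffun 'I_d -> F} := [ffun m => x 0 m].
have finj : injective f.
  by move=> x y /ffunP E; apply/rowP => m; have := E m; rewrite !ffunE.
rewrite -(card_imset _ finj).
have cf : #|family (fun m => mem (Rt m))| = (\prod_m #|Rt m|)%N.
  by rewrite card_family foldrE big_map enumT.
apply: (@leq_trans #|family (fun m => mem (Rt m))|).
  apply/subset_leq_card/subsetP => g /imsetP[x]; rewrite inE => /and3P[/mem_H2set xV /eqP xa /eqP xb] ->.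
  apply/familyP => m; rewrite ffunE /Rt; case: ltnP => m1; first by rewrite inE xV // xa xb.
  case: eqVneq => [->|ne]; first by rewrite inE xa.
  rewrite inE -xb; suff -> : m = i1 by [].
  by apply/val_inj; move: ne m1; rewrite -val_eqE /=; case: (nat_of_ord m) => [|[]].
rewrite cf -[X in (_ <= _ ^ X)%N]card_ord -prod_nat_const; exact: leq_prod.
Qed.

Lemma card_by_fibers (X : {set 'rV[F]_d}) (W : {set F * F}) : X \subset V ->
  (forall x, x \in X -> (x 0 i0, x 0 i1) \in W) -> (#|X| <= #|W| * d ^ d)%N.
Proof.
move=> XV XW; rewrite -sum1_card (partition_big (fun x : 'rV[F]_d => (x 0 i0, x 0 i1)) (mem W)) //=.
rewrite -sum_nat_const; apply: leq_sum => -[a b] _; rewrite sum1_card.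
apply: leq_trans (card_H2set_fiber a b); apply/subset_leq_card/subsetP => x.
rewrite unfold_in /= => /andP[xX /eqP[<- <-]].
by rewrite inE (subsetP XV) // !eqxx.
Qed.

Lemma card_H2set_le : (#|V| <= d ^ d * #|F| ^ 2)%N.
Proof.
have := @card_by_fibers V [set: _] (subxx _) (fun x _ => in_setT _).
by rewrite cardsT card_prod mulnC -mulnn.
Qed.

(** Points with x_0 nonzero are scalings of points x / x_0 of the curve, with at most C values of t.
    Those with x_0 = 0 have at most q values of x_1, whence C + 1. *)
Lemma card_H2set_section (xi : 'rV[F]_d) (C : nat) :
    (forall S : {set F}, (forall t, t \in S -> on_section (fun m => xi 0 m) t) -> (#|S| <= C)%N) ->
  (#|[set x in V | (dot x xi == 0)%R]| <= (C.+1 * d ^ d) * #|F|)%N.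
Proof.
move=> HC; set X := [set x in V | _].
pose S := [set t | [exists x in X, (x 0 i0 != 0) && (t == x 0 i1 / x 0 i0)]].
have sS : (#|S| <= C)%N.
  apply: HC => t; rewrite inE => /existsP[x /and3P[]]; rewrite inE => /andP[/mem_H2set xV /eqP xd] x0 /eqP->.
  exists (fun m => x 0 m / x 0 i0); split => [m m0|m m1|m m1|].
  - have -> : m = i0 by apply/val_inj; rewrite /= m0.
    exact: divff.
  - by have -> : m = i1 by apply/val_inj; rewrite /= m1.
  - rewrite !exprMn xV // mulrDl exprVn divff //; exact: expf_neq0.
  transitivity (dot x xi / x 0 i0); last by rewrite xd mul0r.
  rewrite /dot mulr_suml; apply: eq_bigr => m _.
  by rewrite mulrCA mulrA.
pose W := (setX [set 0] [set: F]) :|: [set (p.1, p.1 * p.2) | p in setX [set: F] S].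
have sW : (#|W| <= C.+1 * #|F|)%N.
  apply: leq_trans (leq_card_setU _ _).1 _; rewrite cardsX cards1 cardsT mul1n mulSn leq_add2l.
  apply: leq_trans (leq_imset_card _ _) _; rewrite cardsX cardsT mulnC leq_mul2r sS orbT //.
rewrite mulnAC; apply: leq_trans (card_by_fibers (W := W) _ _) _; last by rewrite leq_mul2r sW orbT.
  by apply/subsetP => x; rewrite inE => /andP[].
move=> x xX; rewrite inE; case: (eqVneq (x 0 i0) 0) => [->|x0].
  by rewrite in_setX !inE eqxx.
apply/orP; right; apply/imsetP; exists (x 0 i0, x 0 i1 / x 0 i0); last first.
  by rewrite /= mulrCA divff // mulr1.
rewrite in_setX inE /= inE; apply/existsP; exists x; rewrite xX x0 eqxx //.
Qed.

(** Each good t, with chosen roots, spans a punctured line in the cone, and distinct t give disjoint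
    ones. The factor 2 absorbs q - 1 against q. *)
Lemma card_H2set_ge (M : nat) : (#|F| <= M * #|simultaneous_powers F d|)%N ->
  (#|F| ^ 2 <= 2 * M * #|V|)%N.
Proof.
move=> HM; set G := simultaneous_powers F d in HM *.
pose y t (m : nat) : F := odflt 0 [pick y : F | y ^+ m == 1 + t ^+ m].
have yP t (m : 'I_d) : t \in G -> (1 < m)%N -> y t m ^+ m = 1 + t ^+ m.
  rewrite inE => /forallP/(_ m)/implyP H /H/existsP[z /eqP Hz].
  by rewrite /y; case: pickP => [w /eqP //|/(_ z)]; rewrite Hz eqxx.
pose f (p : F * F) : 'rV[F]_d := \row_m (p.1 * (if m == i0 then 1 else if m == i1 then p.2 else y p.2 m)).
have fV p : p \in setX [set~ 0] G -> f p \in V.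
  case: p => a t; rewrite in_setX => /andP[_ pG]; apply/mem_H2set => m m1; rewrite !mxE eqxx /=.
  have -> : (m == i0) = false by rewrite -val_eqE /= gtn_eqF // ltnW.
  have -> : (m == i1) = false by rewrite -val_eqE /= gtn_eqF.
  by rewrite mulr1 !exprMn yP // mulrDr mulr1.
have finj : {in setX [set~ 0] G &, injective f}.
  move=> [a s] [b t]; rewrite !in_setX !inE /= => /andP[a0 _] /andP[b0 _] /rowP E.
  have := E i0; rewrite !mxE eqxx /= !mulr1 => ab; have := E i1; rewrite !mxE /= ab.
  by rewrite ?eqxx => /(mulfI b0)->.
have : (#|F|.-1 * #|G| <= #|V|)%N.
  rewrite -(cardsC1 (0 : F)) -cardsX -(card_in_imset finj); apply/subset_leq_card/subsetP => x.
  by case/imsetP => p pG ->; exact: fV.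
move=> leV; have q1 : (#|F| <= 2 * #|F|.-1)%N.
  have := finNzRing_gt1 F; move: #|F| => q; lia.
apply: (@leq_trans (2 * #|F|.-1 * (M * #|G|))); first by rewrite -mulnn leq_mul.
have -> : (2 * #|F|.-1 * (M * #|G|) = 2 * M * (#|F|.-1 * #|G|))%N by ring.
by rewrite leq_mul2l leV orbT.
Qed.
End Variety.

(** * The L^2 estimate *)

Section Radon.
Variables (R : realFieldType) (F : finFieldType) (d : nat).
Local Notation G := 'rV[F]_d.
Implicit Types (f g : G -> R) (x y z xi : G).

Lemma dotBl x y xi : dot (x - y) xi = dot x xi - dot y xi.
Proof. by rewrite /dot -sumrB; apply: eq_bigr => m _; rewrite !mxE mulrBl. Qed.

Lemma dotDr x y z : dot x (y + z) = dot x y + dot x z.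
Proof. by rewrite /dot -big_split; apply: eq_bigr => m _; rewrite !mxE mulrDr. Qed.

Lemma dotZr (c : F) x y : dot x (c *: y) = c * dot x y.
Proof. by rewrite /dot mulr_sumr; apply: eq_bigr => m _; rewrite !mxE mulrCA. Qed.

Lemma dotZl (c : F) x y : dot (c *: x) y = c * dot x y.
Proof. by rewrite /dot mulr_sumr; apply: eq_bigr => m _; rewrite !mxE mulrA. Qed.

Lemma card_orthogonal z : z != 0 -> (#|F| * #|[set xi | (dot z xi == 0)%R]| = #|F| ^ d)%N.
Proof.
move=> z0; have [m zm] : exists m, z 0 m != 0.
  apply/existsP; apply: contraNT z0; rewrite negb_exists => /forallP z0.
  by apply/eqP/rowP => m; rewrite mxE; apply/eqP; have := z0 m; rewrite negbK.
pose e : G := (z 0 m)^-1 *: delta_mx 0 m.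
have ze : dot z e = 1.
  rewrite dotZr /dot (bigD1 m) //= mxE !eqxx mulr1 big1 ?addr0 ?mulVf // => j /negbTE nej.
  by rewrite mxE nej andbF mulr0.
have fib (c : F) : #|[set xi | dot z xi == c]| = #|[set xi | dot z xi == 0]|.
  have inj : injective (fun xi => xi + c *: e) by exact: addIr.
  rewrite -[RHS](card_imset _ inj); apply: eq_card => xi; rewrite inE; apply/eqP/imsetP.
    move=> zx; exists (xi - c *: e); last by rewrite subrK.
    by rewrite inE -scaleNr dotDr dotZr ze zx mulr1 subrr.
  by case=> xi'; rewrite inE => /eqP zx ->; rewrite dotDr dotZr ze zx mulr1 add0r.
transitivity #|[set: G]|; last by rewrite cardsT card_mx mul1n.
rewrite -sum_nat_const -[RHS]sum1_card [RHS](partition_big (fun xi => dot z xi) predT) //=.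
apply: eq_bigr => c _; rewrite -(fib c) -sum1_card.
by apply: eq_bigl => xi; rewrite !inE.
Qed.

Definition radon f xi (c : F) : R := \sum_(y | dot y xi == c) f y.

Lemma sum_radon f xi : \sum_c radon f xi c = \sum_y f y.
Proof. by rewrite /radon [RHS](partition_big (fun y => dot y xi) predT). Qed.

(** Distinct y and z lie on the same level of xi for exactly n0 directions xi, and y = z for all q^d
    of them. *)
Lemma radon_plancherel f (n0 : nat) : (0 < d)%N -> (#|F| * n0 = #|F| ^ d)%N ->
  \sum_xi \sum_c radon f xi c ^+ 2 =
  n0%:R * (\sum_y f y) ^+ 2 + ((#|F| ^ d)%:R - n0%:R) * \sum_y f y ^+ 2.
Proof.
move=> d0 n0E.
have E1 xi : \sum_c radon f xi c ^+ 2 = \sum_y \sum_z f y * f z * (dot (y - z) xi == 0)%:R.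
  transitivity (\sum_y f y * radon f xi (dot y xi)).
    rewrite [RHS](partition_big (fun y => dot y xi) predT) //=; apply: eq_bigr => c _.
    by rewrite expr2 {1}/radon mulr_suml; apply: eq_bigr => y /eqP->.
  apply: eq_bigr => y _.
  rewrite /radon mulr_sumr big_mkcond; apply: eq_bigr => z _.
  by rewrite dotBl subr_eq0 eq_sym; case: eqP; rewrite ?mulr1 ?mulr0.
under eq_bigr do rewrite E1.
rewrite exchange_big /=; under eq_bigr do rewrite exchange_big /=.
have E2 y z : \sum_xi f y * f z * (dot (y - z) xi == 0)%:R =
    n0%:R * (f y * f z) + (if z == y then ((#|F| ^ d)%:R - n0%:R) * f y ^+ 2 else 0).
  rewrite -mulr_sumr -natr_sum; case: eqVneq => [->|ne].
    rewrite subrr; have -> : (\sum_xi (dot (0 : G) xi == 0)%R = #|F| ^ d)%N.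
      rewrite (eq_bigr (fun _ => 1%N)) => [|xi _]; first by rewrite sum1_card card_mx mul1n.
      by rewrite /dot big1 ?eqxx // => m _; rewrite mxE mul0r.
    by rewrite expr2; ring.
  have yz0 : y - z != 0 by rewrite subr_eq0 eq_sym.
  have -> : (\sum_xi (dot (y - z)%R xi == 0)%R = n0)%N.
    transitivity #|[set xi | (dot (y - z)%R xi == 0)%R]|.
      rewrite -sum1_card [RHS]big_mkcond; apply: eq_bigr => xi _.
      by rewrite inE; case: eqP.
    apply/eqP; rewrite -(eqn_pmul2l (ltnW (finNzRing_gt1 F))) n0E card_orthogonal //.
  by rewrite addr0 mulrC.
under eq_bigr => y _ do under eq_bigr => z _ do rewrite E2.
under eq_bigr => y _ do rewrite big_split -big_mkcond big_pred1_eq -mulr_sumr -mulr_sumr /=.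
by rewrite big_split -!mulr_sumr -mulr_suml expr2.
Qed.

Section Cone.
Variables (H : {set G}) (L : nat).
Hypothesis Hcone : forall (c : F) x, x \in H -> c *: x \in H.
Hypothesis HL : forall xi (b : F), xi != 0 -> (#|[set x in H | (dot x xi == b)%R]| <= L)%N.
Hypothesis d0 : (0 < d)%N.

Definition convsum f y : R := \sum_(x in H) f (y - x).

Lemma sum_convsum f : \sum_y convsum f y = #|H|%:R * \sum_y f y.
Proof.
rewrite exchange_big /= -sumr_const mulr_suml; apply: eq_bigr => x _; rewrite mul1r.
by rewrite [RHS](reindex_inj (addIr (- x))).
Qed.

Lemma card_section_cone xi (b : F) : b != 0 ->
  #|[set x in H | dot x xi == b]| = #|[set x in H | dot x xi == 1]|.
Proof.
move=> b0; rewrite -[RHS](card_imset _ (scalerI b0)); apply: eq_card => x; rewrite inE.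
apply/andP/imsetP => [[xH /eqP xb]|[y]].
  exists (b^-1 *: x); last by rewrite scalerA divff ?scale1r.
  by rewrite inE Hcone // dotZl xb mulVf //=.
by rewrite inE => /andP[yH /eqP y1] ->; rewrite Hcone // dotZl y1 mulr1 eqxx.
Qed.

(* Since H is a cone, x -> x.xi takes all nonzero values equally often on H, so
   the Radon transform diagonalises the convolution on mean-zero functions. *)
Lemma radon_convsum f xi c : \sum_y f y = 0 ->
  radon (convsum f) xi c =
  (#|[set x in H | dot x xi == 0]|%:R - #|[set x in H | dot x xi == 1]|%:R) * radon f xi c.
Proof.
move=> f0; have E1 : radon (convsum f) xi c = \sum_(x in H) radon f xi (c - dot x xi).
  rewrite /radon /convsum exchange_big; apply: eq_bigr => x _.
  rewrite [RHS](reindex_inj (addIr (- x))) /=; apply: eq_bigl => y.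
  by rewrite dotBl (inj_eq (addIr _)).
rewrite E1 (partition_big (fun x => dot x xi) predT) //=.
have E2 b : \sum_(x in H | dot x xi == b) radon f xi (c - dot x xi) =
    #|[set x in H | dot x xi == b]|%:R * radon f xi (c - b).
  rewrite (eq_bigr (fun _ => radon f xi (c - b))) => [|x /andP[_ /eqP->] //].
  by rewrite sumr_const mulr_natl; congr (_ *+ _); apply: eq_card => x; rewrite inE.
under eq_bigr do rewrite E2.
rewrite (bigD1 0) //= subr0 mulrBl; congr (_ + _).
under eq_bigr => b b0 do rewrite card_section_cone //.
rewrite -mulr_sumr -mulrN; congr (_ * _); apply/eqP; rewrite -addr_eq0; apply/eqP.
rewrite -[RHS]f0 -(sum_radon f xi) [RHS](reindex_inj (subrI c)) [RHS](bigD1 0) //= subr0.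
by rewrite addrC.
Qed.

(** Both sides carry the same Plancherel factor, so the bound can be checked for each xi. There the
    multiplier is a difference of two counts in [0, L], and xi = 0 contributes nothing because f has
    mean zero. *)
Lemma convsum_L2 f : \sum_y f y = 0 ->
  \sum_y convsum f y ^+ 2 <= L%:R ^+ 2 * \sum_y f y ^+ 2.
Proof.
move=> f0; have c0 : \sum_y convsum f y = 0 by rewrite sum_convsum f0 mulr0.
pose n0 := (#|F| ^ d.-1)%N.
have n0E : (#|F| * n0 = #|F| ^ d)%N by rewrite -expnS prednK.
have gap : 0 < (#|F| ^ d)%:R - n0%:R :> R.
  by rewrite subr_gt0 ltr_nat -n0E ltn_Pmull ?finNzRing_gt1 // expn_gt0 (ltnW (finNzRing_gt1 F)).
have P1 := radon_plancherel f d0 n0E; have P2 := radon_plancherel (convsum f) d0 n0E.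
rewrite f0 expr0n mulr0 add0r in P1; rewrite c0 expr0n mulr0 add0r in P2.
rewrite -(ler_pM2l gap) mulrCA -P1 -P2 mulr_sumr; apply: ler_sum => xi _.
rewrite mulr_sumr; apply: ler_sum => c _; rewrite radon_convsum // exprMn.
case: (eqVneq xi 0) => [->|xi0].
  suff -> : radon f 0 c = 0 by rewrite expr0n !mulr0.
  have dot0 y : dot y 0 = 0 by rewrite /dot big1 // => m _; rewrite mxE mulr0.
  rewrite /radon; under eq_bigl do rewrite dot0.
  by case: eqVneq => _; [rewrite f0|rewrite big_pred0].
apply: ler_wpM2r; first exact: sqr_ge0.
have := HL 0 xi0; have := HL 1 xi0; rewrite -!(ler_nat R).
have := ler0n R #|[set x in H | dot x xi == 0]|; have := ler0n R #|[set x in H | dot x xi == 1]|.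
by move: (_%:R) (_%:R) (L%:R) => u v w; nra.
Qed.

(** Cauchy-Schwarz is replaced by uv <= (w/L) u^2 + (L/w) v^2. Keeping w free lets it vary with the
    dyadic level before the levels are summed. *)
Lemma bilinear_discrepancy f g (w : R) : (0 < L)%N -> 0 < w ->
  \sum_y convsum f y * g y <=
  #|H|%:R / (#|F| ^ d)%:R * (\sum_y f y) * (\sum_y g y) +
  L%:R * (w * (\sum_y f y ^+ 2) + w^-1 * (\sum_y g y ^+ 2)).
Proof.
move=> L0 w0; pose N : R := (#|F| ^ d)%:R; pose mu := (\sum_y f y) / N.
have N0 : 0 < N by rewrite ltr0n expn_gt0 (ltnW (finNzRing_gt1 F)).
have sum_mu : \sum_(y : G) mu = \sum_y f y.
  by rewrite sumr_const card_mx mul1n -mulr_natl /mu mulrC divfK // gt_eqF.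
pose f0 y := f y - mu.
have sum_f0 : \sum_y f0 y = 0 by rewrite /f0 sumrB sum_mu subrr.
have f0_le : \sum_y f0 y ^+ 2 <= \sum_y f y ^+ 2.
  have -> : \sum_y f y ^+ 2 = \sum_y f0 y ^+ 2 + \sum_(y : G) (mu ^+ 2) + 2 * mu * \sum_y f0 y.
    by rewrite mulr_sumr -!big_split; apply: eq_bigr => y _; rewrite /f0 /=; ring.
  rewrite sum_f0 mulr0 addr0 lerDl; apply: sumr_ge0 => y _; exact: sqr_ge0.
have conv_f y : convsum f y = #|H|%:R * mu + convsum f0 y.
  rewrite mulr_natl -sumr_const /convsum -big_split; apply: eq_bigr => x _.
  by rewrite /f0 /= addrC subrK.
have L0' : 0 < L%:R :> R by rewrite ltr0n.
have amgm (u v : R) : u * v <= w / L%:R * u ^+ 2 + L%:R / w * v ^+ 2.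
  set r := w / L%:R; have r0 : 0 < r by rewrite divr_gt0.
  have -> : L%:R / w = r^-1 by rewrite invf_div.
  have sq : 0 <= (r * u - v) ^+ 2 + (r * u) ^+ 2 + v ^+ 2 by rewrite !addr_ge0 ?sqr_ge0.
  have E : r * (r * u ^+ 2 + r^-1 * v ^+ 2) = (r * u) ^+ 2 + v ^+ 2 by field; rewrite gt_eqF.
  by rewrite -(ler_pM2l r0) E; nra.
have -> : \sum_y convsum f y * g y = #|H|%:R * mu * (\sum_y g y) + \sum_y convsum f0 y * g y.
  by rewrite mulr_sumr -big_split; apply: eq_bigr => y _; rewrite conv_f mulrDl.
have -> : #|H|%:R / N * (\sum_y f y) = #|H|%:R * mu by rewrite /mu; ring.
rewrite lerD2l; apply: (@le_trans _ _ (\sum_y (w / L%:R * convsum f0 y ^+ 2 + L%:R / w * g y ^+ 2))).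
  by apply: ler_sum => y _; exact: amgm.
rewrite big_split /= -!mulr_sumr mulrDr; apply: lerD; last by rewrite mulrA.
have := convsum_L2 sum_f0; move/(ler_wpM2l (ltW (divr_gt0 w0 L0'))) => /le_trans; apply.
have -> : w / L%:R * (L%:R ^+ 2 * \sum_y f0 y ^+ 2) = L%:R * (w * \sum_y f0 y ^+ 2).
  rewrite expr2 !mulrA; congr (_ * _); rewrite mulrAC -[_ / _ * _ * _]mulrA.
  by field; rewrite gt_eqF.
by rewrite !ler_pM2l.
Qed.
End Cone.
End Radon.

(** * The critical exponent *)

Section Levels.
Variable R : realFieldType.
Implicit Types a b x : R.

Definition dyadic_level (i : nat) (x : R) : bool := 2 ^+ i <= x < 2 ^+ i.+1.

Lemma sum_dyadic_level (I : nat) x :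
  \sum_(i < I) (dyadic_level i x)%:R = (1 <= x < 2 ^+ I)%R%:R :> R.
Proof.
elim: I => [|I IHI]; first by rewrite big_ord0 expr0; case: (lerP 1 x).
rewrite big_ord_recr /= IHI /dyadic_level.
have le1 : 1 <= 2 ^+ I :> R by rewrite exprn_ege1 // ler1n.
have le2 : 2 ^+ I <= 2 ^+ I.+1 :> R by rewrite exprS ler_peMl ?ler1n // exprn_ge0.
case: (ltrP x (2 ^+ I)) => h1 /=; first by rewrite (lt_le_trans h1 le2) andbT addr0.
by rewrite andbF add0r (le_trans le1 h1).
Qed.

Lemma sum_dyadic_squares (I : nat) (q b : R) : 0 <= b -> 0 <= q ->
  \sum_(i < I) (2 ^+ i * b) ^+ 2 * (2 ^+ i * b <= q)%R%:R <= 2 * q ^+ 2.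
Proof.
move=> b0 q0; suff [] : 3 * \sum_(i < I) (2 ^+ i * b) ^+ 2 * (2 ^+ i * b <= q)%R%:R <= (2 ^+ I * b) ^+ 2
  /\ 3 * \sum_(i < I) (2 ^+ i * b) ^+ 2 * (2 ^+ i * b <= q)%R%:R <= 4 * q ^+ 2.
  by move=> _; have := sqr_ge0 q; lra.
elim: I => [|I [IH1 IH2]].
  by rewrite big_ord0 mulr0 sqr_ge0; split=> //; have := sqr_ge0 q; lra.
rewrite big_ord_recr /=; move: IH1 IH2; set s := \sum_(i < I) _ => IH1 IH2.
have E : (2 ^+ I.+1 * b) ^+ 2 = 4 * (2 ^+ I * b) ^+ 2 by rewrite [2 ^+ I.+1]exprS; ring.
rewrite E; have c0 : 0 <= 2 ^+ I * b by rewrite mulr_ge0 // exprn_ge0.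
move: (2 ^+ I * b) c0 IH1 => c c0 IH1.
by case: (lerP c q) => cq; rewrite ?mulr1 ?mulr0; split; nra.
Qed.

Lemma expr_le_1D (m n : nat) x : (m <= n)%N -> 0 <= x -> x ^+ m <= 1 + x ^+ n.
Proof.
move=> mn x0; case: (lerP x 1) => x1.
  by apply: (@le_trans _ _ 1); [exact: exprn_ile1|rewrite lerDl exprn_ge0].
by apply: (@le_trans _ _ (x ^+ n)); [rewrite ler_weXn2l // ltW|rewrite lerDr].
Qed.
End Levels.

Section Critical.
Variables (R : realFieldType) (F : finFieldType) (d : nat).
Local Notation G := 'rV[F]_d.
Variables (H : {set G}) (C : nat).
Hypothesis Hcone : forall (c : F) x, x \in H -> c *: x \in H.
Hypothesis HL : forall xi (b : F), xi != 0 -> (#|[set x in H | (dot x xi == b)%R]| <= C * #|F|)%N.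
Hypothesis H_large : (#|F| ^ 2 <= C * #|H|)%N.
Hypothesis C0 : (0 < C)%N.
Hypothesis d3 : (3 <= d)%N.
Local Notation q := (#|F|%:R : R).
Local Notation N := ((#|F| ^ d)%:R : R).
Local Notation conv f := (@convsum R F d H f).

Lemma convsum_le_total (f g : G -> R) : (forall x, 0 <= f x) -> (forall x, 0 <= g x) ->
  \sum_y conv f y * g y <= (\sum_x f x) * \sum_y g y.
Proof.
move=> f0 g0; rewrite mulr_sumr; apply: ler_sum => y _; apply: ler_wpM2r; first exact: g0.
rewrite /convsum big_mkcond [leRHS](reindex_inj (subrI y)); apply: ler_sum => x _ /=.
by case: ifP.
Qed.

(* Only a is cut dyadically. Pairs with a b > q are handled by the trivial
   kernel bound, those with 2^i b <= q by the L^2 discrepancy with weight q / 4^i,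
   for which both quadratic terms sum geometrically to O(q N). *)
Lemma critical_bilinear (a b : G -> R) :
    (forall x, 0 <= a x) -> (forall x, 0 <= b x) ->
    \sum_x a x ^+ (2 * d.-1) <= N -> \sum_x b x ^+ (2 * d.-1) <= N ->
  \sum_y conv (fun x => a x ^+ d) y * b y ^+ d <= (7 + 7 * C ^ 2)%:R * #|H|%:R * N.
Proof.
(* At the vertex, 1/p and 1 - 1/r both equal d / e, so a^d and b^d play symmetric roles. *)
move=> a0 b0 aN bN; set e := (2 * d.-1)%N in aN bN.
have de : (d <= e)%N by rewrite /e; lia.
have q0 : 0 < q by rewrite ltr0n (ltnW (finNzRing_gt1 F)).
have N0 : 0 < N by rewrite ltr0n expn_gt0 (ltnW (finNzRing_gt1 F)).
have half (c : G -> R) : (forall x, 0 <= c x) -> \sum_x c x ^+ e <= N -> \sum_x c x ^+ d <= 2 * N.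
  move=> c0 cN; apply: (@le_trans _ _ (\sum_(x : G) (1 + c x ^+ e))).
    by apply: ler_sum => x _; apply: expr_le_1D.
  by rewrite big_split /= sumr_const card_mx mul1n; lra.
pose I := (#|F| ^ d)%N.
(* The number of levels may be huge: no estimate below counts them. *)
have aI x : a x < 2 ^+ I.
  apply: (@le_lt_trans _ _ N); last by rewrite -natrX ltr_nat ltn_expl.
  case: (lerP (a x) 1) => ax; first by apply: le_trans ax _; rewrite ler1n -(ltr0n R).
  apply: le_trans aN; rewrite (bigD1 x) //=.
  apply: (@le_trans _ _ (a x ^+ e)).
    by rewrite -[leLHS]expr1 ler_weXn2l ?(ltW ax) // (leq_trans _ de) // (leq_trans _ d3).
  by rewrite lerDl sumr_ge0 // => y _; rewrite exprn_ge0.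
pose f0 x := a x ^+ d * (a x < 1)%R%:R.
pose f (i : 'I_I) x := a x ^+ d * (dyadic_level i (a x))%:R.
pose g x := b x ^+ d.
pose gle (i : 'I_I) x := b x ^+ d * (2 ^+ i * b x <= q)%R%:R.
pose ggt (i : 'I_I) x := b x ^+ d * (q < 2 ^+ i * b x)%R%:R.
have fE x : a x ^+ d = f0 x + \sum_i f i x.
  rewrite /f0 /f -mulr_sumr sum_dyadic_level aI andbT -mulrDr.
  by case: (ltrP (a x) 1); rewrite ?addr0 ?add0r mulr1.
have f0_ge x : 0 <= f0 x by rewrite mulr_ge0 ?exprn_ge0 ?ler0n.
have f_ge i x : 0 <= f i x by rewrite mulr_ge0 ?exprn_ge0 ?ler0n.
have g_ge x : 0 <= g x by rewrite exprn_ge0.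
have gle_ge i x : 0 <= gle i x by rewrite mulr_ge0 ?exprn_ge0 ?ler0n.
have ggt_ge i x : 0 <= ggt i x by rewrite mulr_ge0 ?exprn_ge0 ?ler0n.
have split_sum : \sum_y conv (fun x => a x ^+ d) y * b y ^+ d =
   \sum_y conv f0 y * g y + \sum_i \sum_y conv (f i) y * gle i y + \sum_i \sum_y conv (f i) y * ggt i y.
  rewrite -addrA -big_split /=; under [X in _ = _ + X]eq_bigr do rewrite -big_split /=.
  rewrite [X in _ + X]exchange_big /= -big_split /=; apply: eq_bigr => y _ /=.
  have -> : conv (fun x => a x ^+ d) y = conv f0 y + \sum_i conv (f i) y.
    rewrite /convsum [X in _ + X]exchange_big -big_split /=; apply: eq_bigr => x _; exact: fE.
  rewrite mulrDl; congr (_ + _); rewrite mulr_suml; apply: eq_bigr => i _.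
  rewrite -mulrDr /gle /ggt -mulrDr; congr (_ * _).
  by case: (lerP (2 ^+ i * b y) q); rewrite ?addr0 ?add0r mulr1.
have qH : q ^+ 2 <= C%:R * #|H|%:R by rewrite -natrX -natrM ler_nat.
have low : \sum_y conv f0 y * g y <= 2 * #|H|%:R * N.
  apply: (@le_trans _ _ (\sum_y #|H|%:R * g y)).
    apply: ler_sum => y _; apply: ler_wpM2r; first exact: g_ge.
    rewrite -sumr_const; apply: ler_sum => x _; rewrite /f0.
    case: (ltrP (a (y - x)) 1) => ax; rewrite ?mulr1 ?mulr0 //.
    by rewrite exprn_ile1 // ltW.
  rewrite -mulr_sumr [2 * _]mulrC -mulrA; apply: ler_wpM2l; first exact: ler0n.
  exact: half.
(* Here a b > q, so (a b)^d <= (a b)^e / q^(d - 2) since e = d + (d - 2). The trivial kernel bound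
   then gives N^2 / q^(d - 2) = q^2 N, and q^2 <= C |H|. *)
have far : \sum_i \sum_y conv (f i) y * ggt i y <= C%:R * #|H|%:R * N.
  have pt z y : \sum_i f i z * ggt i y <= a z ^+ e * b y ^+ e / q ^+ (d - 2).
    have one i : f i z * ggt i y <= (dyadic_level i (a z))%:R * (a z ^+ e * b y ^+ e / q ^+ (d - 2)).
      rewrite /f /ggt; case: (boolP (dyadic_level i (a z))) => [/andP[lo _]|_]; last by rewrite !(mulr0, mul0r).
      rewrite mulr1 mul1r; case: (ltrP q (2 ^+ i * b y)) => big; last first.
        by rewrite !mulr0 !mulr_ge0 ?invr_ge0 ?exprn_ge0 // ltW.
      rewrite mulr1 ler_pdivlMr ?exprn_gt0 // -!exprMn.
      have -> : e = (d + (d - 2))%N by rewrite /e; lia.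
      rewrite exprD; apply: ler_wpM2l; first by rewrite exprn_ge0 // mulr_ge0.
      apply: lerXn2r; rewrite ?nnegrE ?mulr_ge0 ?(ltW q0) //.
      by apply: le_trans (ltW big) _; apply: ler_wpM2r.
    apply: le_trans (ler_sum _ (fun i _ => one i)) _; rewrite -mulr_suml sum_dyadic_level.
    have c0 : 0 <= a z ^+ e * b y ^+ e / q ^+ (d - 2) by rewrite !mulr_ge0 ?invr_ge0 ?exprn_ge0 // ltW.
    by case: (_ && _); rewrite ?mul1r ?mul0r.
  apply: (@le_trans _ _ (\sum_z \sum_y (a z ^+ e * b y ^+ e / q ^+ (d - 2)))).
    apply: (@le_trans _ _ (\sum_z \sum_y \sum_i f i z * ggt i y)); last first.
      by apply: ler_sum => z _; apply: ler_sum => y _; exact: pt.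
    under [leRHS]eq_bigr do rewrite exchange_big.
    rewrite [leRHS]exchange_big; apply: ler_sum => i _.
    apply: le_trans (convsum_le_total (f_ge i) (ggt_ge i)) _.
    by rewrite mulr_suml; apply: ler_sum => z _; rewrite mulr_sumr.
  have -> : \sum_z \sum_y a z ^+ e * b y ^+ e / q ^+ (d - 2) =
      (\sum_z a z ^+ e) * (\sum_y b y ^+ e) / q ^+ (d - 2).
    by rewrite !mulr_suml; apply: eq_bigr => z _; rewrite mulr_sumr mulr_suml.
  rewrite ler_pdivrMr ?exprn_gt0 //.
  apply: (@le_trans _ _ (N * N)).
    by apply: ler_pM => //; apply: sumr_ge0 => x _; rewrite exprn_ge0.
  rewrite [leRHS]mulrAC ler_pM2r //.
  have -> : N = q ^+ 2 * q ^+ (d - 2) by rewrite -exprD natrX; congr (_ ^+ _); lia.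
  by rewrite ler_pM2r ?exprn_gt0.
have near_main : \sum_(i < I) (\sum_x f i x) * (\sum_x gle i x) <= 4 * N ^+ 2.
  apply: (@le_trans _ _ (\sum_(i < I) (\sum_x f i x) * (2 * N))).
    apply: ler_sum => i _; apply: ler_wpM2l; first exact: sumr_ge0.
    apply: le_trans (half _ b0 bN); apply: ler_sum => x _; rewrite /gle.
    by case: (2 ^+ i * b x <= q); rewrite ?mulr1 // mulr0 exprn_ge0.
  rewrite -mulr_suml; have -> : 4 * N ^+ 2 = (2 * N) * (2 * N) by ring.
  apply: ler_wpM2r; first by rewrite mulr_ge0 // ltW.
  apply: le_trans (half _ a0 aN); rewrite exchange_big; apply: ler_sum => x _ /=.
  by rewrite fE lerDr.
(* On level i, a < 2^(i + 1), so a^(2d) = a^2 a^e <= 4 * 4^i a^e; the weight cancels 4^i and each x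
   lies on at most one level. *)
have near_f : \sum_(i < I) q / 4 ^+ i * (\sum_x f i x ^+ 2) <= 4 * q * N.
  apply: (@le_trans _ _ (\sum_x 4 * q * a x ^+ e)); last first.
    by rewrite -mulr_sumr ler_pM2l // mulr_gt0.
  under eq_bigr do rewrite mulr_sumr.
  rewrite exchange_big; apply: ler_sum => x _ /=.
  apply: (@le_trans _ _ (\sum_(i < I) (dyadic_level i (a x))%:R * (4 * q * a x ^+ e))).
    apply: ler_sum => i _; rewrite /f.
    case: (boolP (dyadic_level i (a x))) => [/andP[_ hi]|_]; last by rewrite mulr0 expr0n mulr0 mul0r.
    rewrite mulr1 mul1r -exprM (_ : (d * 2 = 2 + e)%N); last by rewrite /e; lia.
    rewrite exprD !mulrA; apply: ler_wpM2r; first exact: exprn_ge0.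
    rewrite [4 * q]mulrC -!mulrA; apply: ler_wpM2l; first exact: ltW.
    rewrite mulrC -expr2 ler_pdivrMr ?exprn_gt0 //.
    have -> : 4 * 4 ^+ i = (2 ^+ i.+1) ^+ 2 :> R by rewrite -exprM mulnC exprM -exprS; congr (_ ^+ _); ring.
    by apply: lerXn2r; rewrite ?nnegrE ?exprn_ge0 // ltW.
  rewrite -mulr_suml sum_dyadic_level.
  have c0 : 0 <= 4 * q * a x ^+ e by rewrite !mulr_ge0 ?exprn_ge0 // ltW.
  by case: (_ && _); rewrite ?mul1r ?mul0r.
have near_g : \sum_(i < I) 4 ^+ i / q * (\sum_x gle i x ^+ 2) <= 2 * q * N.
  apply: (@le_trans _ _ (\sum_x 2 * q * b x ^+ e)); last first.
    by rewrite -mulr_sumr ler_pM2l // mulr_gt0.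
  under eq_bigr do rewrite mulr_sumr.
  rewrite exchange_big; apply: ler_sum => x _ /=.
  have -> : \sum_(i < I) 4 ^+ i / q * gle i x ^+ 2 =
      b x ^+ e / q * \sum_(i < I) (2 ^+ i * b x) ^+ 2 * (2 ^+ i * b x <= q)%R%:R.
    rewrite mulr_sumr; apply: eq_bigr => i _; rewrite /gle.
    have -> : 4 ^+ i = (2 ^+ i) ^+ 2 :> R by rewrite -exprM mulnC exprM; congr (_ ^+ _); ring.
    have E : (b x ^+ d) ^+ 2 = b x ^+ e * b x ^+ 2.
      by rewrite -exprM -exprD; congr (_ ^+ _); rewrite /e; lia.
    case: (2 ^+ i * b x <= q); rewrite ?mulr1 ?mulr0 ?expr0n ?mulr0 // E exprMn.
    by move: (b x ^+ e) ((2 ^+ i) ^+ 2) (b x ^+ 2) => u v w; ring.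
  have -> : 2 * q * b x ^+ e = b x ^+ e / q * (2 * q ^+ 2) by field; rewrite gt_eqF.
  apply: ler_wpM2l; first by rewrite divr_ge0 ?exprn_ge0 // ltW.
  by apply: sum_dyadic_squares => //; exact: ltW.
have near : \sum_i \sum_y conv (f i) y * gle i y <= 4 * #|H|%:R * N + 6 * C%:R * q ^+ 2 * N.
  have step i : \sum_y conv (f i) y * gle i y <=
     #|H|%:R / N * ((\sum_x f i x) * (\sum_x gle i x)) +
     C%:R * q * (q / 4 ^+ i * (\sum_x f i x ^+ 2) + 4 ^+ i / q * (\sum_x gle i x ^+ 2)).
    have w0 : 0 < q / 4 ^+ i by rewrite divr_gt0 ?exprn_gt0.
    have L0 : (0 < C * #|F|)%N by rewrite muln_gt0 C0 (ltnW (finNzRing_gt1 F)).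
    have d0 : (0 < d)%N by rewrite (leq_trans _ d3).
    have := bilinear_discrepancy Hcone HL d0 (f i) (gle i) L0 w0.
    by rewrite invf_div natrM mulrA.
  apply: le_trans (ler_sum _ (fun i _ => step i)) _.
  rewrite big_split /= -!mulr_sumr big_split /=.
  apply: lerD.
    have -> : 4 * #|H|%:R * N = #|H|%:R / N * (4 * N ^+ 2) by field; rewrite gt_eqF.
    by apply: ler_wpM2l => //; rewrite divr_ge0 ?ler0n.
  have -> : 6 * C%:R * q ^+ 2 * N = C%:R * q * (4 * q * N + 2 * q * N) by ring.
  by apply: ler_wpM2l; [rewrite mulr_ge0 ?ler0n | exact: lerD].
(* The three parts give 2, 4 + 6 C^2 and C <= C^2 times |H| N. *)
rewrite split_sum natrD natrM natrX.
have C1 : 1 <= C%:R :> R by rewrite ler1n.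
have H0 : 0 <= #|H|%:R :> R by rewrite ler0n.
have C2 : C%:R * (C%:R * #|H|%:R) <= C%:R ^+ 2 * #|H|%:R :> R by rewrite expr2 mulrA.
have CC : C%:R * #|H|%:R <= C%:R ^+ 2 * #|H|%:R :> R.
  by rewrite expr2 -mulrA ler_peMl // mulr_ge0 ?ler0n.
have q2 : C%:R * q ^+ 2 <= C%:R ^+ 2 * #|H|%:R by rewrite expr2 -mulrA ler_wpM2l ?ler0n.
have q2N : C%:R * q ^+ 2 * N <= C%:R ^+ 2 * #|H|%:R * N by rewrite ler_wpM2r // ltW.
have CCN : C%:R * #|H|%:R * N <= C%:R ^+ 2 * #|H|%:R * N by rewrite ler_wpM2r // ltW.
have HN : 0 <= #|H|%:R * N by rewrite mulr_ge0 // ltW.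
have -> : (7 + 7 * C%:R ^+ 2) * #|H|%:R * N = 7 * (#|H|%:R * N) + 7 * (C%:R ^+ 2 * #|H|%:R * N) by ring.
move: low near far q2N CCN HN; rewrite -![_ * #|H|%:R * N]mulrA -![_ * _ * q ^+ 2 * N]mulrA.
move: (C%:R * (q ^+ 2 * N)) (C%:R * (#|H|%:R * N)) (C%:R ^+ 2 * (#|H|%:R * N)) (#|H|%:R * N).
move=> u v w z; lra.
Qed.
End Critical.

(** * Interpolation *)

Arguments exp x%_ring_scope.
Arguments ln x%_ring_scope.
Arguments Rpower (x y)%_ring_scope.

Section RealPowers.
Implicit Types x y u v : R.

Lemma rpow0 y : rpow 0 y = 0.
Proof. by rewrite /rpow; case: Req_dec_T. Qed.

Lemma rpow_pos x y : 0 < x -> rpow x y = Rpower x y.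
Proof. by rewrite /rpow; case: Req_dec_T => //= x0; rewrite x0 ltxx. Qed.

Lemma Rpower_gt0 x y : 0 < Rpower x y.
Proof. by apply/RltP; exact: exp_pos. Qed.

Lemma rpow_ge0 x y : 0 <= rpow x y.
Proof. by rewrite /rpow; case: Req_dec_T => //= _; exact: ltW (Rpower_gt0 _ _). Qed.

Lemma rpow_gt0 x y : 0 < x -> 0 < rpow x y.
Proof. by move=> x0; rewrite rpow_pos // Rpower_gt0. Qed.

Lemma rpow_eq0 x y : 0 <= x -> (rpow x y == 0) = (x == 0).
Proof.
rewrite le_eqVlt => /orP[/eqP<-|x0]; first by rewrite rpow0 eqxx.
by rewrite !gt_eqF // rpow_gt0.
Qed.

Lemma rpowD x u v : 0 <= x -> rpow x (u + v) = rpow x u * rpow x v.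
Proof.
rewrite le_eqVlt => /orP[/eqP<-|x0]; first by rewrite !rpow0 mulr0.
by rewrite !rpow_pos // Rpower_plus.
Qed.

Lemma rpowM x u v : 0 <= x -> rpow (rpow x u) v = rpow x (u * v).
Proof.
rewrite le_eqVlt => /orP[/eqP<-|x0]; first by rewrite !rpow0.
by rewrite !rpow_pos ?Rpower_gt0 // Rpower_mult.
Qed.

Lemma rpow1 x : 0 <= x -> rpow x 1 = x.
Proof.
rewrite le_eqVlt => /orP[/eqP<-|x0]; first by rewrite rpow0.
by rewrite rpow_pos // Rpower_1 //; apply/RltP.
Qed.

Lemma rpowr0 x : 0 < x -> rpow x 0 = 1.
Proof. by move=> x0; rewrite rpow_pos // Rpower_O //; apply/RltP. Qed.

Lemma rpow_mul x y u : 0 <= x -> 0 <= y -> rpow (x * y) u = rpow x u * rpow y u.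
Proof.
rewrite le_eqVlt => /orP[/eqP<-|x0]; first by rewrite mul0r !rpow0 mul0r.
rewrite le_eqVlt => /orP[/eqP<-|y0]; first by rewrite mulr0 !rpow0 mulr0.
rewrite !rpow_pos ?mulr_gt0 //; apply/esym/Rpower_mult_distr; exact/RltP.
Qed.

Lemma rpowN x u : 0 < x -> rpow x (- u) = (rpow x u)^-1.
Proof. by move=> x0; rewrite !rpow_pos // Rpower_Ropp. Qed.

Lemma rpow_inv x u : 0 <= x -> rpow x^-1 u = (rpow x u)^-1.
Proof.
rewrite le_eqVlt => /orP[/eqP<-|x0]; first by rewrite invr0 !rpow0 invr0.
apply: (mulIf (lt0r_neq0 (rpow_gt0 u x0))).
rewrite -rpow_mul ?invr_ge0 ?ltW // !mulVf ?gt_eqF ?rpow_gt0 //.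
by rewrite rpow_pos // /Rpower ln_1 Rmult_0_r exp_0.
Qed.

Lemma rpow_nat x (n : nat) : (0 < n)%N -> 0 <= x -> rpow x n%:R = x ^+ n.
Proof.
move=> n0; rewrite le_eqVlt => /orP[/eqP<-|x0]; first by rewrite rpow0 expr0n gtn_eqF.
by rewrite rpow_pos // -INRE Rpower_pow ?RpowE //; apply/RltP.
Qed.

Lemma ler_rpow x y u : 0 <= u -> 0 <= x -> x <= y -> rpow x u <= rpow y u.
Proof.
move=> u0; rewrite le_eqVlt => /orP[/eqP<-|x0] xy; first by rewrite rpow0 rpow_ge0.
rewrite !rpow_pos ?(lt_le_trans x0) //.
apply/RleP; apply: Rle_Rpower_l; first exact/RleP.
by split; [apply/RltP|apply/RleP].
Qed.

Lemma exp_weighted_amgm (wa wb wc we za zb zc ze : R) :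
  0 <= wa -> 0 <= wb -> 0 <= wc -> 0 <= we -> wa + wb + wc + we = 1 ->
  exp (wa * za + wb * zb + wc * zc + we * ze) <=
  wa * exp za + wb * exp zb + wc * exp zc + we * exp ze.
Proof.
move=> a0 b0 c0 e0 sum1; set m := wa * za + wb * zb + wc * zc + we * ze.
(* Convexity of exp through its tangent line at the weighted mean. *)
have tangent z : exp m * (1 + (z - m)) <= exp z.
  have -> : exp z = exp m * exp (z - m).
    by rewrite expRD RplusE; congr exp; rewrite addrCA subrr addr0.
  apply: ler_wpM2l; first by apply/ltW/RltP; exact: exp_pos.
  by apply/RleP; exact: exp_ineq1_le.
have := ler_wpM2l a0 (tangent za); have := ler_wpM2l b0 (tangent zb).
have := ler_wpM2l c0 (tangent zc); have := ler_wpM2l e0 (tangent ze).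
have : exp m * (wa * za + wb * zb + wc * zc + we * ze - m) = 0 by rewrite subrr mulr0.
have : exp m * (wa + wb + wc + we) = exp m by rewrite sum1 mulr1.
move: m tangent => m _; move: (exp m) => X E1 E2 h1 h2 h3 h4.
have E3 : wa * (X * (1 + (za - m))) + wb * (X * (1 + (zb - m))) + wc * (X * (1 + (zc - m))) +
   we * (X * (1 + (ze - m))) = X * (wa + wb + wc + we) + X * (wa * za + wb * zb + wc * zc + we * ze - m)
   + X * m * (1 - (wa + wb + wc + we)) by ring.
rewrite sum1 subrr mulr0 in E3; lra.
Qed.

(** The monomials y, 1, x and x^th y^th, with weights wa, wb, wc, we, belong to the vertices (0,0),
    (0,1), (1,1) and the critical one: x carries the exponent s and y the exponent 1 - t. *)
Lemma rpow_interpolation (wa wb wc we th x y : R) : 0 <= x -> 0 <= y ->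
    0 <= wa -> 0 <= wb -> 0 <= wc -> 0 <= we -> wa + wb + wc + we = 1 ->
  rpow x (wc + we * th) * rpow y (wa + we * th) <=
  wb + wc * x + wa * y + we * (rpow x th * rpow y th).
Proof.
move=> x0 y0 a0 b0 c0 e0 sum1.
have rhs : 0 <= wb + wc * x + wa * y + we * (rpow x th * rpow y th).
  by rewrite !addr_ge0 ?mulr_ge0 ?rpow_ge0.
move: x0; rewrite le_eqVlt => /orP[/eqP xE|x0].
  by move: rhs; rewrite -xE !rpow0 !mul0r.
move: y0; rewrite le_eqVlt => /orP[/eqP yE|y0].
  by move: rhs; rewrite -yE !rpow0 !mulr0.
have := @exp_weighted_amgm wa wb wc we (ln y) 0 (ln x) (th * ln x + th * ln y) a0 b0 c0 e0 sum1.
rewrite exp_0 !exp_ln; try exact/RltP.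
rewrite !rpow_pos // /Rpower !expRD !RplusE !RmultE.
have -> : (((wc + we * th) * ln x)%R + ((wa + we * th) * ln y)%R)%R =
  wa * ln y + wb * 0 + wc * ln x + we * (th * ln x + th * ln y) by rewrite /=; ring.
by rewrite mulr1 => /le_trans; apply; lra.
Qed.
End RealPowers.

Lemma convex_combination_le (wa wb wc we h u v B K : R) :
    0 <= wa -> 0 <= wb -> 0 <= wc -> 0 <= we -> wa + wb + wc + we = 1 ->
    0 <= h -> 0 <= K -> u <= h -> v <= h -> B <= K * h ->
  wb * h + wc * u + wa * v + we * B <= (1 + K) * h.
Proof.
move=> a0 b0 c0 e0 sum1 h0 K0 hu hv hB.
have Kh : 0 <= K * h by rewrite mulr_ge0.
have -> : (1 + K) * h = (wa + wb + wc + we) * (h + K * h) by rewrite sum1; ring.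
have := ler_wpM2l c0 hu; have := ler_wpM2l a0 hv; have := ler_wpM2l e0 hB.
have := mulr_ge0 a0 Kh; have := mulr_ge0 b0 Kh; have := mulr_ge0 c0 Kh; have := mulr_ge0 e0 h0.
move: (K * h) Kh => k _; lra.
Qed.

Section Interpolation.
Variables (F : finFieldType) (d : nat).
Local Notation G := 'rV[F]_d.
Variables (H : {set G}) (C : nat).
Hypothesis Hcone : forall (c : F) x, x \in H -> c *: x \in H.
Hypothesis HL : forall xi (b : F), xi != 0 -> (#|[set x in H | (dot x xi == b)%R]| <= C * #|F|)%N.
Hypothesis H_large : (#|F| ^ 2 <= C * #|H|)%N.
Hypothesis C0 : (0 < C)%N.
Hypothesis d3 : (3 <= d)%N.
Local Notation N := ((#|F| ^ d)%:R : R).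
Local Notation csum f := (@convsum R F d H f).
Local Notation th := ((d%:R : R) / (2 * d.-1)%:R).

Lemma interpolated_bilinear (U V : G -> R) (wa wb wc we : R) :
    (forall x, 0 <= U x) -> (forall x, 0 <= V x) ->
    \sum_x U x <= N -> \sum_x V x <= N ->
    0 <= wa -> 0 <= wb -> 0 <= wc -> 0 <= we -> wa + wb + wc + we = 1 ->
  \sum_y csum (fun x => rpow (U x) (wc + we * th)) y * rpow (V y) (wa + we * th) <=
  (8 + 7 * C ^ 2)%:R * #|H|%:R * N.
Proof.
move=> U0 V0 UN VN a0 b0 c0 e0 sum1.
have N0 : 0 < N by rewrite ltr0n expn_gt0 (ltnW (finNzRing_gt1 F)).
pose e := (2 * d.-1)%N; have e_gt0 : (0 < e)%N by rewrite /e; lia.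
have e0' : (e%:R : R) != 0 by rewrite pnatr_eq0 -lt0n.
have root_e (W : G -> R) x : 0 <= W x -> (rpow (W x) e%:R^-1) ^+ e = W x.
  by move=> W0; rewrite -rpow_nat ?rpow_ge0 // rpowM // mulVf // rpow1.
have root_d (W : G -> R) x : 0 <= W x -> (rpow (W x) e%:R^-1) ^+ d = rpow (W x) th.
  by move=> W0; rewrite -rpow_nat ?rpow_ge0 ?(leq_trans _ d3) // rpowM // mulrC.
(* The vertex estimate for a = U^(1/e) and b = V^(1/e), so that a^d = U^th. *)
have crit : \sum_y csum (fun x => rpow (U x) th) y * rpow (V y) th <= (7 + 7 * C ^ 2)%:R * #|H|%:R * N.
  have := @critical_bilinear R F d H C Hcone HL H_large C0 d3
    (fun x => rpow (U x) e%:R^-1) (fun x => rpow (V x) e%:R^-1).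
  move=> /(_ (fun x => rpow_ge0 _ _) (fun x => rpow_ge0 _ _)).
  have sum_root (W : G -> R) : (forall x, 0 <= W x) -> \sum_x W x <= N ->
      \sum_x rpow (W x) e%:R^-1 ^+ e <= N.
    by move=> W0; congr (_ <= _); apply: eq_bigr => x _; rewrite root_e.
  move=> /(_ (sum_root _ U0 UN) (sum_root _ V0 VN)); congr (_ <= _); apply: eq_bigr => y _; rewrite root_d //.
  by congr (_ * _); apply: eq_bigr => x _; rewrite root_d.
apply: (@le_trans _ _ (\sum_y \sum_(x in H) (wb + wc * U (y - x) + wa * V y +
    we * (rpow (U (y - x)) th * rpow (V y) th)))).
  apply: ler_sum => y _; rewrite /convsum mulr_suml; apply: ler_sum => x _.
  exact: rpow_interpolation.
have -> : \sum_y \sum_(x in H) (wb + wc * U (y - x) + wa * V y +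
    we * (rpow (U (y - x)) th * rpow (V y) th)) =
  wb * (#|H|%:R * N) + wc * (#|H|%:R * \sum_x U x) + wa * (#|H|%:R * \sum_x V x) +
  we * \sum_y csum (fun x => rpow (U x) th) y * rpow (V y) th.
  rewrite -sum_convsum.
  have -> : N = \sum_(y : G) 1 by rewrite sumr_const card_mx mul1n.
  rewrite !mulr_sumr -!big_split; apply: eq_bigr => y _ /=.
  rewrite /convsum !big_split /= sumr_const -!mulr_sumr sumr_const -mulr_suml.
  by rewrite -[wb *+ _]mulr_natl -[V y *+ _]mulr_natl; ring.
have h0 : 0 <= #|H|%:R :> R by rewrite ler0n.
have UN' : #|H|%:R * \sum_x U x <= #|H|%:R * N by rewrite ler_wpM2l.
have VN' : #|H|%:R * \sum_x V x <= #|H|%:R * N by rewrite ler_wpM2l.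
have K0 : 0 <= (7 + 7 * C ^ 2)%:R :> R by rewrite ler0n.
have HN : 0 <= #|H|%:R * N by rewrite mulr_ge0 // ltW.
have -> : (8 + 7 * C ^ 2)%:R = 1 + (7 + 7 * C ^ 2)%:R :> R by rewrite !natrD; ring.
rewrite -[X in _ <= X]mulrA in crit; rewrite -[leRHS]mulrA.
exact: convex_combination_le.
Qed.

Lemma averaging_Lp_bound (f : G -> R) (wa wb wc we s t : R) :
    (0 < #|H|)%N -> (forall x, 0 <= f x) ->
    0 <= wa -> 0 <= wb -> 0 <= wc -> 0 <= we -> wa + wb + wc + we = 1 ->
    s = wc + we * th -> 1 - t = wa + we * th -> 0 < s -> 0 < t ->
  rpow ((\sum_y rpow (csum f y / #|H|%:R) t^-1) / N) t <=
  (8 + 7 * C ^ 2)%:R * rpow ((\sum_x rpow (f x) s^-1) / N) s.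
Proof.
move=> H_gt0 f0 a0 b0 c0 e0 sum1 sE tE s0 t0.
have N0 : 0 < N by rewrite ltr0n expn_gt0 (ltnW (finNzRing_gt1 F)).
have h0 : 0 < #|H|%:R :> R by rewrite ltr0n.
pose h y := csum f y / #|H|%:R.
have h_ge y : 0 <= h y by rewrite divr_ge0 ?ler0n // /convsum sumr_ge0.
set P := (\sum_x rpow (f x) s^-1) / N; set Q := (\sum_y rpow (h y) t^-1) / N.
have P_ge : 0 <= P by rewrite divr_ge0 ?(ltW N0) // sumr_ge0 // => x _; rewrite rpow_ge0.
have Q_ge : 0 <= Q by rewrite divr_ge0 ?(ltW N0) // sumr_ge0 // => x _; rewrite rpow_ge0.
have B0 : 0 <= (8 + 7 * C ^ 2)%:R :> R by rewrite ler0n.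
move: Q_ge; rewrite le_eqVlt => /orP[/eqP<-|Q0]; first by rewrite rpow0 mulr_ge0 // rpow_ge0.
have P0 : 0 < P.
  rewrite lt_def P_ge andbT; apply: contraTN Q0 => /eqP P0; rewrite -leNgt.
  have f_eq0 x : f x = 0.
    apply/eqP; rewrite -(rpow_eq0 s^-1) //; apply/eqP.
    move/eqP: P0; rewrite mulf_eq0 invr_eq0 (gt_eqF N0) orbF psumr_eq0 => [/allP/(_ x)|y _].
      by rewrite mem_index_enum => /(_ isT)/eqP.
    exact: rpow_ge0.
  rewrite /Q big1 ?mul0r // => y _; rewrite /h /convsum big1 ?mul0r ?rpow0 // => x _.
(* Duality: V^(1-t) is proportional to h^(1/t - 1), so h V^(1-t) ~ h^(1/t). *)
pose U x := rpow (f x) s^-1 / P; pose V y := rpow (h y) t^-1 / Q.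
have U_ge x : 0 <= U x by rewrite divr_ge0 ?rpow_ge0.
have V_ge x : 0 <= V x by rewrite divr_ge0 ?rpow_ge0 ?ltW.
have sumU : \sum_x U x <= N by rewrite -mulr_suml ler_pdivrMr // /P mulrC divfK // gt_eqF.
have sumV : \sum_x V x <= N by rewrite -mulr_suml ler_pdivrMr // /Q mulrC divfK // gt_eqF.
have := interpolated_bilinear U_ge V_ge sumU sumV a0 b0 c0 e0 sum1.
rewrite -sE -tE.
have US x : rpow (U x) s = f x / rpow P s.
  by rewrite rpow_mul ?rpow_ge0 ?invr_ge0 // rpowM // mulVf ?gt_eqF // rpow1 // rpow_inv.
have term y : csum (fun x => rpow (U x) s) y * rpow (V y) (1 - t) =
    #|H|%:R / rpow P s * rpow Q (t - 1) * rpow (h y) t^-1.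
  have -> : csum (fun x => rpow (U x) s) y = #|H|%:R * h y / rpow P s.
    have -> : #|H|%:R * h y = csum f y by rewrite /h mulrC divfK ?gt_eqF.
    by rewrite /convsum mulr_suml; apply: eq_bigr => x _; exact: US.
  rewrite /V rpow_mul ?rpow_ge0 ?invr_ge0 ?(ltW Q0) // rpowM // rpow_inv ?(ltW Q0) //.
  rewrite -(rpowN _ Q0) opprB.
  have -> : rpow (h y) t^-1 = h y * rpow (h y) (t^-1 * (1 - t)).
    rewrite -{2}(rpow1 (h_ge y)) -rpowD //; congr rpow; field; by rewrite gt_eqF.
  by ring.
rewrite (eq_bigr _ (fun y _ => term y)) -mulr_sumr.
have -> : \sum_y rpow (h y) t^-1 = Q * N by rewrite /Q divfK // gt_eqF.
have -> : #|H|%:R / rpow P s * rpow Q (t - 1) * (Q * N) = (rpow Q t / rpow P s) * (#|H|%:R * N).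
  have -> : rpow Q t = rpow Q (t - 1) * Q.
    by rewrite -{3}(rpow1 (ltW Q0)) -rpowD ?ltW // subrK.
  by ring.
rewrite -[leRHS]mulrA ler_pM2r ?mulr_gt0 // ler_pdivrMr ?rpow_gt0 //.
Qed.
End Interpolation.

Lemma large_char_pchar (F : finFieldType) (K : nat) :
  (forall p : nat, p \in [pchar F] -> (K < p)%N) -> large_char F K.
Proof.
move=> HK m /andP[m0 mK]; have [p p_pr pcharF] := finPcharP F.
rewrite -(dvdn_pcharf pcharF); apply/negP => /(dvdn_leq m0) le_pm.
by have := leq_trans (HK p pcharF) (leq_trans le_pm mK); rewrite ltnn.
Qed.

Lemma H2set_geometry (d : nat) : (3 <= d)%N -> exists K C : nat, (0 < C)%N /\
  forall F : finFieldType, large_char F K ->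
  (#|F| ^ 2 <= C * #|H2set F d|)%N /\
  forall (xi : 'rV[F]_d) (b : F), xi != 0 ->
    (#|[set x in H2set F d | (dot x xi == b)%R]| <= C * #|F|)%N.
Proof.
move=> d3; have d2 := ltnW d3.
have [K1 [C1 HC1]] := hyperplane_section_bound d2.
have [K2 [M HM]] := simultaneous_powers_lower_bound d2.
exists (K1 + K2)%N, (C1.+1 * d ^ d + 2 * d ^ d + 2 * M).+1%N; split=> // F char0.
have ch1 : large_char F K1 by apply: large_charW char0; exact: leq_addr.
have ch2 : large_char F K2 by apply: large_charW char0; exact: leq_addl.
split.
  apply: leq_trans (card_H2set_ge d3 (HM F ch2)) _; rewrite leq_mul2r; apply/orP; right.
  by apply: leq_trans (leqnSn _); exact: leq_addl.
move=> xi b xi0; case: (eqVneq b 0) => [->|b0].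
  apply: leq_trans (card_H2set_section d3 (C := C1) _) _.
    apply: HC1 => //; apply/existsP; apply: contraNT xi0; rewrite negb_exists => /forallP H0.
    by apply/eqP/rowP => m; rewrite mxE; apply/eqP; have := H0 m; rewrite negbK.
  by rewrite leq_mul2r; apply/orP; right; apply: leq_trans (leqnSn _); rewrite -addnA leq_addr.
have q0 : (0 < #|F|)%N := ltnW (finNzRing_gt1 F).
apply: (@leq_trans (2 * d ^ d * #|F|)); last first.
  rewrite leq_mul2r; apply/orP; right; apply: leq_trans (leqnSn _).
  by rewrite -addnA addnCA leq_addr.
rewrite -(leq_pmul2l q0).
set n := #|[set x in _ | _]|.
(* All nonzero levels have the same size, so q - 1 copies of it fit into H_2, which has O(q^2)
   points. *)
have nE : (#|F|.-1 * n <= #|H2set F d|)%N.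
  rewrite -[leqRHS]sum1_card (partition_big (fun x => dot x xi) predT) //=.
  rewrite (bigD1 0) //=; apply: leq_trans (leq_addl _ _).
  rewrite -(cardC1 (0 : F)) -sum_nat_const; apply: eq_leq; apply: eq_bigr => c c0.
  rewrite /n (card_section_cone (H2set_scale d3) xi b0) -(card_section_cone (H2set_scale d3) xi c0).
  by rewrite -sum1_card; apply: eq_bigl => x; rewrite inE.
have q2 : (#|F| <= 2 * #|F|.-1)%N by move: (finNzRing_gt1 F); move: #|F| => q; lia.
apply: (@leq_trans (2 * (#|F|.-1 * n))); first by rewrite mulnA leq_mul2r q2 orbT.
apply: (@leq_trans (2 * (d ^ d * #|F| ^ 2))).
  by rewrite leq_mul2l (leq_trans nE) // card_H2set_le.
by apply: eq_leq; ring.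
Qed.

(** * Complex functions and their L^p norms *)

Section ComplexFunctions.

Lemma cmodE (z : Cx) : cmod z = Num.sqrt (z.1 ^+ 2 + z.2 ^+ 2).
Proof. by rewrite /cmod RsqrtE !expr2. Qed.

Lemma cmod_ge0 z : 0 <= cmod z.
Proof. by rewrite cmodE sqrtr_ge0. Qed.

Lemma cmod_sum_le (I : finType) (A : {set I}) (f : I -> Cx) :
  cmod (\sum_(i in A) (f i).1, \sum_(i in A) (f i).2) <= \sum_(i in A) cmod (f i).
Proof.
have cmodD (z w : Cx) : cmod (z.1 + w.1, z.2 + w.2) <= cmod z + cmod w.
  have := cmod_ge0 z; have := cmod_ge0 w; have E (v : Cx) : cmod v ^+ 2 = v.1 ^+ 2 + v.2 ^+ 2.
    by rewrite cmodE sqr_sqrtr // addr_ge0 ?sqr_ge0.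
  have := E z; have := E w; have := E (z.1 + w.1, z.2 + w.2); have := cmod_ge0 (z.1 + w.1, z.2 + w.2).
  case: z => a b; case: w => c e /=.
  move: (cmod (a + c, b + e)) (cmod (a, b)) (cmod (c, e)) => u v w u0 E1 E2 E3 w0 v0.
  have cs : (a * c + b * e) <= w * v.
    case: (lerP (a * c + b * e) 0) => [h|h]; first by rewrite (le_trans h) // mulr_ge0.
    rewrite -(@ler_pXn2r _ 2) // ?nnegrE ?mulr_ge0 ?(ltW h) // exprMn E3 E2.
    by have := sqr_ge0 (a * e - b * c); lra.
  by rewrite -(@ler_pXn2r _ 2) // ?nnegrE ?addr_ge0 //; lra.
elim: (index_enum I) => [|i s IHs].
  by rewrite !big_nil cmodE /= expr0n addr0 sqrtr0.
rewrite !big_cons; case: ifP => // _; apply: le_trans (cmodD (f i) (_, _)) _.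
by rewrite lerD2l.
Qed.

Variables (F : finFieldType) (d : nat).
Local Notation G := 'rV[F]_d.
Local Notation N := ((#|F| ^ d)%:R : R).
Implicit Types (f : G -> Cx).

Lemma Lnorm0E f : Lnorm 0 f = maxR (fun x => cmod (f x)).
Proof. by rewrite /Lnorm; case: Req_dec_T. Qed.

Lemma LnormE s f : s != 0 -> Lnorm s f = rpow ((\sum_x rpow (cmod (f x)) s^-1) / N) s.
Proof. by move=> /eqP s0; rewrite /Lnorm; case: Req_dec_T => //= _; rewrite INRE. Qed.

Lemma le_maxR (g : G -> R) x : g x <= maxR g.
Proof.
rewrite /maxR; have := mem_index_enum x; elim: (index_enum _) => [//|y s IHs].
rewrite inE big_cons RmaxE le_max => /orP[/eqP->|/IHs->]; by rewrite ?lexx ?orbT.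
Qed.

Lemma maxR_le (g : G -> R) M : 0 <= M -> (forall x, g x <= M) -> maxR g <= M.
Proof.
move=> M0 gM; rewrite /maxR; elim/big_ind: _ => // [u v uM vM].
by rewrite RmaxE ge_max uM.
Qed.

Lemma cmod_conv_le (H : {set G}) f y :
  cmod (conv H f y) <= @convsum R F d H (fun x => cmod (f x)) y / #|H|%:R.
Proof.
have -> : conv H f y = ((\sum_(x in H) (f (y - x)).1) / #|H|%:R, (\sum_(x in H) (f (y - x)).2) / #|H|%:R).
  by rewrite /conv /sumIn !INRE.
have scale (u v c : R) : 0 <= c -> cmod (u * c, v * c) = cmod (u, v) * c.
  move=> c0; rewrite !cmodE /= !exprMn -mulrDl sqrtrM ?addr_ge0 ?sqr_ge0 //.
  by rewrite sqrtr_sqr ger0_norm.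
rewrite scale ?invr_ge0 ?ler0n // ler_wpM2r ?invr_ge0 ?ler0n //.
exact: (cmod_sum_le H (fun x => f (y - x))).
Qed.

Lemma Lnorm_le_max f t M : 0 <= t -> 0 <= M -> (forall x, cmod (f x) <= M) -> Lnorm t f <= M.
Proof.
move=> t0 M0 fM; case: (eqVneq t 0) => [->|tn0]; first by rewrite Lnorm0E; exact: maxR_le.
have t1 : 0 < t by rewrite lt_def tn0.
have N0 : 0 < N by rewrite ltr0n expn_gt0 (ltnW (finNzRing_gt1 F)).
rewrite LnormE // -[leRHS](rpow1 M0) -[X in rpow M X](mulVf tn0) -rpowM //; apply: ler_rpow => //.
  by rewrite divr_ge0 ?(ltW N0) // sumr_ge0 // => x _; rewrite rpow_ge0.
rewrite ler_pdivrMr // mulr_natr; have -> : (#|F| ^ d)%N = #|{: G}| by rewrite card_mx mul1n.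
rewrite -sumr_const; apply: ler_sum => x _; apply: ler_rpow; rewrite ?invr_ge0 //.
exact: cmod_ge0.
Qed.
End ComplexFunctions.

(** * The hull by weights and by inequalities *)

Section Hull.
Variable d : nat.
Hypothesis d3 : (3 <= d)%N.
Local Notation th := ((d%:R : R) / (2 * d.-1)%:R).

Lemma predn_natr : (2 * d.-1)%:R = 2 * d%:R - 2 :> R.
Proof.
have -> : d = d.-1.+1 by rewrite prednK // (leq_trans _ d3).
by rewrite /= natrM -natr1; ring.
Qed.

Lemma hull_denominator_gt0 : 0 < 2 * d%:R - 2 :> R.
Proof. have : 3 <= d%:R :> R by rewrite ler_nat. lra. Qed.

Lemma hull_vertex_lt1 : th < 1.
Proof.
rewrite predn_natr ltr_pdivrMr ?hull_denominator_gt0 // mul1r.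
have : 3 <= d%:R :> R by rewrite ler_nat. lra.
Qed.

Lemma in_hull4P (s t : R) : in_hull4 d s t <-> exists wa wb wc we : R,
  [/\ [/\ 0 <= wa, 0 <= wb, 0 <= wc & 0 <= we], wa + wb + wc + we = 1,
     s = wc + we * th & t = wb + wc + we * (1 - th)].
Proof.
have D0 := hull_denominator_gt0.
have thE : 1 - th = (d%:R - 2) / (2 * d%:R - 2).
  by rewrite predn_natr; field; rewrite gt_eqF.
have P2 : (nat_of_pos 2)%:R = 2 :> R by [].
rewrite /in_hull4 !INRE thE predn_natr; split.
- move=> [wa [wb [wc [we [/RleP a0 [/RleP b0 [/RleP c0 [/RleP e0 [sum1 [sE tE]]]]]]]]]].
  exists wa, wb, wc, we; split=> //; [rewrite sE|rewrite tE]; rewrite !RealsE.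
    rewrite P2; ring.
  rewrite P2; ring.
move=> [wa [wb [wc [we [[a0 b0 c0 e0] sum1 sE tE]]]]].
exists wa, wb, wc, we; do 4 (split; first exact/RleP); split; first exact: sum1.
split; [rewrite sE|rewrite tE]; rewrite !RealsE P2; ring.
Qed.

(** The last two inequalities are the sides joining the critical vertex to (0,0) and to (1,1). *)
Lemma in_hull4_of_ineqs (s t : R) : 0 <= s <= 1 -> 0 <= t <= 1 ->
  (d%:R - 2) * s <= d%:R * t -> d%:R * s <= 2 + (d%:R - 2) * t -> in_hull4 d s t.
Proof.
move=> /andP[s0 s1] /andP[t0 t1] h1 h2; apply/in_hull4P; rewrite predn_natr.
have D0 := hull_denominator_gt0.
(* The diagonal from (0,0) to (1,1) splits the quadrilateral into two triangles. *)
case: (lerP s t) => st.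
  exists (1 - t), (t - s), s, 0; split; [split|ring|ring|ring]; lra.
exists ((2 - d%:R * s + (d%:R - 2) * t) / 2), 0, ((d%:R * t - (d%:R - 2) * s) / 2),
   ((2 * d%:R - 2) * (s - t) / 2).
have E : (2 * d%:R - 2) * (s - t) / 2 * ((d%:R : R) / (2 * d%:R - 2)) = (s - t) / 2 * d%:R.
  by field; rewrite gt_eqF.
have W : 0 <= (2 * d%:R - 2) * (s - t) by apply: mulr_ge0; lra.
split; rewrite ?mulrBr ?E; [split| | |]; rewrite ?mulr1; lra.
Qed.
End Hull.

(** * Boundedness throughout the hull *)

Section Sufficiency.
Variable d : nat.
Hypothesis d3 : (3 <= d)%N.

Lemma PropP_of_hull : exists K : nat, forall s t : R, 0 <= s <= 1 -> 0 <= t <= 1 ->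
  in_hull4 d s t -> PropP d K s t.
Proof.
have [K [C [C0 HKC]]] := H2set_geometry d3.
exists K => s t /andP[s0 s1] /andP[t0 t1].
move=> /(in_hull4P d3)[wa [wb [wc [we [[a0 b0 c0 e0] sum1 sE tE]]]]].
exists (8 + 7 * C ^ 2)%:R; split; first by apply/RltP; rewrite ltr0n.
move=> F HK f; have [HC HL] := HKC F (large_char_pchar HK); apply/RleP; rewrite RmultE.
have H_gt0 : (0 < #|H2set F d|)%N.
  by rewrite lt0n; apply: contraTneq HC => ->; rewrite muln0 -ltnNge expn_gt0 (ltnW (finNzRing_gt1 F)).
have h0 : 0 < #|H2set F d|%:R :> R by rewrite ltr0n.
have N0 : 0 < (#|F| ^ d)%:R :> R by rewrite ltr0n expn_gt0 (ltnW (finNzRing_gt1 F)).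
have B1 : 1 <= (8 + 7 * C ^ 2)%:R :> R by rewrite ler1n.
have vertex := hull_vertex_lt1 d3.
have vertex0 : 0 < (d%:R : R) / (2 * d.-1)%:R.
  apply: divr_gt0; rewrite ltr0n; first by rewrite (leq_trans _ d3).
  by rewrite muln_gt0 -subn1 subn_gt0 (leq_trans _ d3).
case: (eqVneq s 0) => [s_eq|sn0].
  rewrite s_eq Lnorm0E; set M := maxR _.
  have M0 : 0 <= M by apply: le_trans (le_maxR _ 0); exact: cmod_ge0.
  apply: (@le_trans _ _ M); last by rewrite ler_peMl.
  apply: Lnorm_le_max => // y; apply: le_trans (cmod_conv_le _ _ _) _.
  rewrite ler_pdivrMr // mulr_natr -sumr_const /convsum; apply: ler_sum => x _.
  exact: le_maxR.
have s_gt0 : 0 < s by rewrite lt_def sn0.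
(* Among the vertices only (0,0) has t = 0, so t = 0 would force s = 0. *)
case: (eqVneq t 0) => [t_eq|tn0].
  have : 0 < 1 - (d%:R : R) / (2 * d.-1)%:R by rewrite subr_gt0.
  move: vertex0 s_gt0 tE; rewrite sE t_eq; move: (_ / _) => th th0 th1 th2 h; nra.
have t_gt0 : 0 < t by rewrite lt_def tn0.
have tE' : 1 - t = wa + we * ((d%:R : R) / (2 * d.-1)%:R).
  by rewrite tE; move: (_ / _) => th; lra.
rewrite !LnormE //; apply: le_trans _ (averaging_Lp_bound _ HL HC C0 d3 H_gt0 _ a0 b0 c0 e0 sum1 sE tE' s_gt0 t_gt0).
- apply: ler_rpow => //.
    by rewrite divr_ge0 ?(ltW N0) // sumr_ge0 // => y _; rewrite rpow_ge0.
  rewrite ler_pM2r ?invr_gt0 //; apply: ler_sum => y _; apply: ler_rpow.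
  + by rewrite invr_ge0.
  + exact: cmod_ge0.
  exact: cmod_conv_le.
- by move=> c x; exact: H2set_scale.
by move=> x; exact: cmod_ge0.
Qed.
End Sufficiency.

(** * Necessary conditions *)

Lemma exponent_le0 (K : nat) (A gam : R) :
  (forall p : nat, prime p -> (K < p)%N -> rpow p%:R gam <= A) -> gam <= 0.
Proof.
move=> HA; rewrite leNgt; apply/negP => gam0.
set X := rpow A gam^-1; have X0 : 0 <= X := rpow_ge0 _ _.
have [p ltp p_pr] := prime_above (maxn K (Num.truncn X)).
have ltKp : (K < p)%N by apply: leq_ltn_trans ltp; exact: leq_maxl.
have ltXp : X < p%:R.
  have : (Num.truncn X < p)%N by apply: leq_ltn_trans ltp; exact: leq_maxr.
  by rewrite truncn_lt_nat.
have := ler_rpow (x := rpow p%:R gam) (y := A) (u := gam^-1).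
rewrite invr_ge0 (ltW gam0) rpow_ge0 rpowM ?ler0n // divff ?gt_eqF // rpow1 ?ler0n //.
by move=> /(_ isT isT (HA p p_pr ltKp)) /(lt_le_trans ltXp); rewrite ltxx.
Qed.

Section TestFunctions.
Variables (F : finFieldType) (d : nat).
Local Notation G := 'rV[F]_d.
Local Notation N := ((#|F| ^ d)%:R : R).

Definition indicator (A : {set G}) (c : R) (x : G) : Cx := (if x \in A then c else 0, 0).

Lemma cmod_indicator (A : {set G}) c x : 0 <= c ->
  cmod (indicator A c x) = if x \in A then c else 0.
Proof.
move=> c0; rewrite cmodE /= expr0n addr0 sqrtr_sqr.
by case: ifP => _; rewrite ?normr0 // ger0_norm.
Qed.

Lemma Lnorm_indicator (A : {set G}) (c s : R) : (0 < #|A|)%N -> 0 <= c -> 0 <= s ->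
  Lnorm s (indicator A c) = c * rpow (#|A|%:R / N) s.
Proof.
move=> A0 c0 s0; have N0 : 0 < N by rewrite ltr0n expn_gt0 (ltnW (finNzRing_gt1 F)).
have a0 : 0 < #|A|%:R / N by rewrite divr_gt0 // ltr0n.
case: (eqVneq s 0) => [->|sn0].
  rewrite Lnorm0E rpowr0 // mulr1; apply/eqP; rewrite eq_le; apply/andP; split.
    by apply: maxR_le => // x; rewrite cmod_indicator //; case: ifP.
  have /card_gt0P[x xA] := A0.
  by apply: le_trans (le_maxR _ x); rewrite cmod_indicator // xA.
rewrite LnormE //; have -> : \sum_x rpow (cmod (indicator A c x)) s^-1 = rpow c s^-1 * #|A|%:R.
  rewrite mulr_natr -sumr_const [RHS]big_mkcond; apply: eq_bigr => x _.
  by rewrite cmod_indicator //; case: ifP => // _; rewrite rpow0.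
by rewrite -mulrA rpow_mul ?rpow_ge0 ?(ltW a0) // rpowM // mulVf // rpow1.
Qed.

Lemma Lnorm_ge_point (f : G -> Cx) x t : 0 <= t -> cmod (f x) * rpow N^-1 t <= Lnorm t f.
Proof.
move=> t0; have N0 : 0 < N by rewrite ltr0n expn_gt0 (ltnW (finNzRing_gt1 F)).
case: (eqVneq t 0) => [->|tn0].
  by rewrite Lnorm0E rpowr0 ?invr_gt0 // mulr1; exact: (le_maxR (fun x => cmod (f x))).
rewrite LnormE // -{1}(rpow1 (cmod_ge0 (f x))) -[X in rpow (cmod (f x)) X](mulVf tn0) -rpowM ?cmod_ge0 //.
rewrite -rpow_mul ?rpow_ge0 ?invr_ge0 ?(ltW N0) //; apply: ler_rpow => //.
  by rewrite mulr_ge0 ?rpow_ge0 // invr_ge0 ltW.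
rewrite ler_pM2r ?invr_gt0 // (bigD1 x) //= lerDl sumr_ge0 // => y _; exact: rpow_ge0.
Qed.

Variable H : {set G}.
Hypothesis H_gt0 : (0 < #|H|)%N.

Lemma conv_delta y : conv H (indicator [set 0] 1) y = indicator H (#|H|%:R^-1) y.
Proof.
rewrite /conv /sumIn /indicator /= INRE; congr (_, _); last first.
  by rewrite big1 // !RealsE mul0r.
rewrite RdivE; case: (boolP (y \in H)) => yH.
  rewrite (bigD1 y) //= /vsub subrr inE eqxx big1 ?addr0 ?mul1r // => [|x /andP[_ ne]].
    by rewrite RplusE addr0 mul1r.
  by rewrite inE subr_eq0 eq_sym (negbTE ne).
rewrite big1 ?mul0r // => x xH; rewrite inE /vsub subr_eq0.
by case: eqP => // yx; rewrite yx xH in yH.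
Qed.

Lemma conv_reflection : conv H (indicator [set - x | x in H] 1) 0 = (1, 0).
Proof.
rewrite /conv /sumIn /indicator /= INRE; congr (_, _); last first.
  by rewrite big1 // !RealsE mul0r.
rewrite RdivE (eq_bigr (fun _ => 1)) => [|x xH].
  have -> : \big[Rplus/0%R]_(i in H) 1 = #|H|%:R by exact: sumr_const.
  by rewrite divff // pnatr_eq0 -lt0n.
by rewrite /vsub sub0r imset_f.
Qed.
End TestFunctions.

Section Necessity.
Variable d : nat.
Hypothesis d3 : (3 <= d)%N.

(** Both tests need only |H_2| <= d^d q^2: the first uses it with exponent s >= 0, the second with t
    - 1 <= 0. Every K is allowed, since arbitrarily large primes remain. *)
Lemma hull_of_PropP (K : nat) (s t : R) : 0 <= s <= 1 -> 0 <= t <= 1 ->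
  PropP d K s t -> in_hull4 d s t.
Proof.
move=> s01 t01; have /andP[s0 s1] := s01; have /andP[t0 t1] := t01.
case=> Cst [/RltP Cst0 HP].
pose B : R := (d ^ d)%:R; have B0 : 0 < B by rewrite ltr0n expn_gt0 (leq_trans _ d3).
have test (p : nat) : prime p -> (K < p)%N ->
    rpow p%:R ((d%:R - 2) * s - d%:R * t) <= Cst * rpow B s /\
    rpow p%:R (d%:R * s - (2 + (d%:R - 2) * t)) <= Cst * rpow B (1 - t).
  move=> p_pr ltKp; pose F : finFieldType := 'F_p.
  have cF : #|F| = p by rewrite card_Fp.
  have HF f : Lnorm t (conv (H2set F d) f) <= Cst * Lnorm s f.
    apply/RleP/HP => p' p'F; have := pchar_Fp p_pr => pF.
    by have := pcharf_eq pF p'; rewrite p'F inE => /esym/eqP->.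
  have p0 : 0 < p%:R :> R by rewrite ltr0n prime_gt0.
  have q0 : 0 <= p%:R :> R by exact: ltW.
  have NE u : rpow ((#|F| ^ d)%:R) u = rpow p%:R (d%:R * u).
    by rewrite cF natrX -rpow_nat ?(leq_trans _ d3) // rpowM.
  have NVE u : rpow ((#|F| ^ d)%:R)^-1 u = rpow p%:R (- (d%:R * u)).
    by rewrite rpow_inv ?ler0n // NE -rpowN.
  set V := H2set F d in HF.
  have V0 : 0 \in V.
    by apply/(mem_H2set d3) => m m1; rewrite !mxE !expr0n gtn_eqF ?addr0 // ltnW.
  have V_gt0 : (0 < #|V|)%N by apply/card_gt0P; exists 0.
  have v0 : 0 < #|V|%:R :> R by rewrite ltr0n.
  have VB : #|V|%:R <= B * p%:R ^+ 2.
    by rewrite -natrX -natrM ler_nat -cF; exact: card_H2set_le.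
  have Bp0 : 0 <= B * p%:R ^+ 2 by rewrite mulr_ge0 ?exprn_ge0 // ltW.
  have Bp u : rpow (B * p%:R ^+ 2) u = rpow B u * rpow p%:R (2 * u).
    by rewrite rpow_mul ?exprn_ge0 ?(ltW B0) // -(rpow_nat (n := 2)) // rpowM.
  split.
    (* The average of the indicator of -H_2 equals 1 at 0, so its norm is at least q^(-d t), while
       the input norm is O(q^((2 - d) s)). *)
    have := le_trans (Lnorm_ge_point _ 0 t0) (HF (indicator [set - x | x in V] 1)).
    rewrite conv_reflection // Lnorm_indicator ?(card_imset _ (@oppr_inj _)) //.
    rewrite cmodE /= expr1n expr0n addr0 sqrtr1 !mul1r NVE.
    rewrite rpow_mul ?ler0n ?invr_ge0 ?ler0n // NVE => h.
    have := ler_rpow s0 (ltW v0) VB; rewrite Bp => h2.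
    have h3 : rpow p%:R (- (d%:R * t)) <= Cst * (rpow B s * rpow p%:R (2 * s) * rpow p%:R (- (d%:R * s))).
      by apply: le_trans h _; rewrite ler_pM2l // ler_wpM2r // rpow_ge0.
    rewrite -mulrA -rpowD // mulrA in h3.
    have -> : (d%:R - 2) * s - d%:R * t = - (d%:R * t) - (2 * s - d%:R * s) by ring.
    by rewrite rpowD // [rpow _ (- (2 * s - _))]rpowN // ler_pdivrMr // rpow_gt0.
  (* The point mass has norm q^(-d s), and its average is 1 / |H_2| on H_2, of norm at least a
     constant times q^(-2 + (2 - d) t). *)
  have := HF (indicator [set 0] 1).
  have -> : Lnorm t (conv V (indicator [set 0] 1)) = Lnorm t (indicator V (#|V|%:R^-1)).
    by rewrite /Lnorm; case: Req_dec_T => /= _; do ?congr rpow; do ?congr (_ / _); apply: eq_bigr => y _; rewrite conv_delta.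
  rewrite !Lnorm_indicator ?cards1 ?invr_ge0 ?ler0n // mulr1n !mul1r NVE.
  rewrite rpow_mul ?ler0n ?invr_ge0 ?ler0n // NVE => h.
  have h1 : rpow (B * p%:R ^+ 2) (t - 1) <= #|V|%:R^-1 * rpow #|V|%:R t.
    have -> : #|V|%:R^-1 * rpow #|V|%:R t = rpow #|V|%:R (t - 1).
      by rewrite addrC rpowD ?ler0n // rpowN // rpow1 ?ler0n.
    rewrite -(opprB 1 t) !rpowN ?(lt_le_trans v0) // lef_pV2 ?posrE ?rpow_gt0 ?(lt_le_trans v0) //.
    by apply: ler_rpow; rewrite ?subr_ge0 ?ler0n.
  have h2 : rpow (B * p%:R ^+ 2) (t - 1) * rpow p%:R (- (d%:R * t)) <= Cst * rpow p%:R (- (d%:R * s)).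
    by apply: le_trans h; rewrite mulrA ler_wpM2r // rpow_ge0.
  rewrite Bp -mulrA -rpowD // in h2.
  have E : rpow B (1 - t) * rpow B (t - 1) = 1.
    by rewrite -rpowD ?ltW // addrC subrKA subrr rpowr0.
  have := ler_wpM2l (rpow_ge0 B (1 - t)) h2; rewrite mulrA E mul1r => h3.
  have -> : d%:R * s - (2 + (d%:R - 2) * t) = (2 * (t - 1) - d%:R * t) - (- (d%:R * s)) by ring.
  rewrite rpowD // [rpow _ (- - _)]rpowN // ler_pdivrMr ?rpow_gt0 //; apply: le_trans h3 _.
  by rewrite mulrA [rpow B _ * Cst]mulrC.
apply: in_hull4_of_ineqs => //.
  by rewrite -subr_le0; apply: (exponent_le0 (K := K)) => p pp ltp; exact: (test p pp ltp).1.
by rewrite -subr_le0; apply: (exponent_le0 (K := K)) => p pp ltp; exact: (test p pp ltp).2.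
Qed.
End Necessity.

Unset Implicit Arguments.
Local Open Scope R_scope.

Theorem theorem1 (d : nat) (hd : (3 <= d)%N) :
  exists K : nat, forall s t : R,
    0 <= s <= 1 -> 0 <= t <= 1 ->
    (PropP d K s t <-> in_hull4 d s t).
Proof.
have [K HK] := PropP_of_hull hd; exists K => s t [/RleP s0 /RleP s1] [/RleP t0 /RleP t1].
have s01 : (0 <= s <= 1)%O by rewrite s0 s1.
have t01 : (0 <= t <= 1)%O by rewrite t0 t1.
by split; [exact: hull_of_PropP | exact: HK].
Qed.
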